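(* Let $\overline{\zeta}$ be a concurrent $\pi$-vector field on a Finsler manifold $(M,L)$, and let $\alpha:=i_{\overline{\zeta}}\,g$, i.e. $\alpha(\overline{X})=g(\overline{\zeta},\overline{X})$, be its associated $\pi$-form. Then $\overline{\zeta}$ and $\alpha$ are independent of the directional argument $y$.
   Context: $M$ is a real paracompact smooth manifold of finite dimension $n$; all objects are $C^\infty$. $\pi:\mathcal{T}M\to M$ is the bundle of nonzero tangent vectors, $\pi^{-1}(TM)\to\mathcal{T}M$ the pullback of $TM$ by $\pi$. Sections of $\pi^{-1}(TM)$ are called $\pi$-vector fields, are written with bars, and form the module $\mathfrak{X}(\pi(M))$; sections of $\pi^{-1}(T^*M)$ are $\pi$-forms. The fundamental $\pi$-vector field is $\overline{\eta}(u)=(u,u)$. $\rho:T(\mathcal{T}M)\to\pi^{-1}(TM)$ is $\rho=(\pi_{\mathcal{T}M},d\pi)$, and $\gamma:\pi^{-1}(TM)\to T(\mathcal{T}M)$ is the vertical lift $\gamma(u,v)=j_u(v)$, with $j_u:T_{\pi(u)}M\to T_u(T_{\pi(u)}M)$ the natural isomorphism. $(M,L)$ is a Finsler manifold with Finsler metric $g$ on $\pi^{-1}(TM)$ (locally $g_{ij}=\frac12\partial^2L^2/\partial y^i\partial y^j$). For a linear connection $D$ on $\pi^{-1}(TM)$ its connection map is $K(X)=D_X\overline{\eta}$; $D$ is regular if $T_u(\mathcal{T}M)=V_u(\mathcal{T}M)\oplus\ker K_u$ for all $u$ ($V$ the vertical bundle), and then its horizontal map is $\beta:=(\rho|_{\ker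 K})^{-1}$. The torsion is $\mathbf{T}(X,Y)=D_X\rho Y-D_Y\rho X-\rho[X,Y]$, with $Q(\overline{X},\overline{Y})=\mathbf{T}(\beta\overline{X},\beta\overline{Y})$ and $T(\overline{X},\overline{Y})=\mathbf{T}(\gamma\overline{X},\beta\overline{Y})$. The Cartan connection $\nabla$ is the unique regular connection on $\pi^{-1}(TM)$ with $\nabla g=0$, $Q=0$ and $g(T(\overline{X},\overline{Y}),\overline{Z})=g(T(\overline{X},\overline{Z}),\overline{Y})$. A $\pi$-vector field $\overline{\zeta}$ is concurrent if $\nabla_{\beta\overline{X}}\overline{\zeta}=-\overline{X}$ and $\nabla_{\gamma\overline{X}}\overline{\zeta}=0$ for all $\overline{X}$. A $\pi$-vector field or $\pi$-form is independent of the directional argument $y$ if, in the natural local coordinates $(x^i,y^i)$ of $\mathcal{T}M$ induced by coordinates $(x^i)$ on $M$, its components (with respect to the frame, resp. coframe, of the pullback bundle induced by $\partial/\partial x^i$, resp. $dx^i$) do not depend on $y$.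
   Formalization: In dimension n = 1, independence of y is claimed only on each half-line y > 0 and y < 0 separately; across the two halves it fails, e.g. M = R, L = |y|, ζ = −(x + c) d/dx with c depending on the sign of y. For n ≥ 2 the claim covers all nonzero y. *)

(* Defs.v *)
From HB Require Import structures.
From mathcomp Require Import all_boot all_order all_algebra.
From mathcomp Require Import all_classical all_reals all_analysis.

Set Implicit Arguments.
Unset Strict Implicit.
Unset Printing Implicit Defensive.

Import Order.TTheory GRing.Theory Num.Theory numFieldNormedType.Exports.
Local Open Scope classical_set_scope.
Local Open Scope ring_scope.

Section Smoothness.
Context {R : realType} {V W : normedModType R}.

(* On an open set O of a finite-dimensional space. *)
Fixpoint is_Ck (k : nat) (O : set V) (f : V -> W) : Prop :=
  match k with
  | 0 => forall x, O x -> {for x, continuous f}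
  | k'.+1 => (forall x, O x -> differentiable f x) /\
             (forall v, is_Ck k' O ('D_v f))
  end.

Definition smooth_on (O : set V) (f : V -> W) : Prop :=
  forall k, is_Ck k O f.

Definition smooth_near (f : V -> W) (x : V) : Prop :=
  exists O : set V, [/\ open O, O x & smooth_on O f].

End Smoothness.

Section Manifolds.
Context {R : realType}.

(* The data of an atlas on T with values in R^m.  [par i] is the inverse of the
   coordinate map [crd i]; both are relevant only on [dom i], [rng i]. *)
Record atlas (T : Type) (m : nat) := Atlas {
  idx : Type;
  dom : idx -> set T;
  crd : idx -> T -> 'rV[R]_m;
  par : idx -> 'rV[R]_m -> T }.

Definition rng T m (A : atlas T m) (i : idx A) : set 'rV[R]_m :=
  crd i @` dom i.

Definition transition T m (A : atlas T m) (i j : idx A) :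
  'rV[R]_m -> 'rV[R]_m := fun x => crd j (par i x).

Definition paracompact (T : topologicalType) : Prop :=
  forall F : set (set T), F `<=` open -> \bigcup_(U in F) U = setT ->
  exists G : set (set T),
    [/\ G `<=` open, \bigcup_(V in G) V = setT,
        (forall V, G V -> exists2 U, F U & V `<=` U) &
        (forall p : T, exists2 N, nbhs p N &
           finite_set [set V | G V /\ V `&` N !=set0])].

Record smooth_manifold (M : topologicalType) n (A : atlas M n) : Prop := {
  mfd_hausdorff : hausdorff_space M;
  mfd_paracompact : paracompact M;
  mfd_cover : forall p : M, exists i : idx A, dom i p;
  mfd_dom_open : forall i : idx A, open (dom i);
  mfd_rng_open : forall i : idx A, open (rng i);
  mfd_crdK : forall (i : idx A) p, dom i p -> par i (crd i p) = p;
  mfd_crd_continuous : forall (i : idx A) p, dom i p ->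
    {for p, continuous (crd i)};
  mfd_par_continuous : forall (i : idx A) x, rng i x ->
    {for x, continuous (par i)};
  mfd_transition : forall i j : idx A,
    smooth_on (crd i @` (dom i `&` dom j)) (transition i j) }.

(* A tangent vector at p is the family of its component vectors in all the
   charts around p, related by the Jacobians of the transition maps.  Charts
   not containing p get the value 0, so that equality of families is equality
   of tangent vectors; the operations are the pointwise ones. *)
Definition tvec T m (A : atlas T m) : Type := idx A -> 'rV[R]_m.

Definition tangent T m (A : atlas T m) (p : T) : set (tvec A) :=
  [set v | (forall i, ~ dom i p -> v i = 0) /\
           (forall i j, dom i p -> dom j p ->
              v j = 'd (transition i j) (crd i p) (v i))].

(* The tangent vector at p with components y in the chart i around p. *)
Definition tvec_of T m (A : atlas T m) (i : idx A) (p : T) (y : 'rV[R]_m) :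
  tvec A :=
  fun j => if `[< dom j p >] then 'd (transition i j) (crd i p) y else 0.

(* The vector d/dx^j at p. *)
Definition coord_vec T m (A : atlas T m) (i : idx A) (p : T) (j : 'I_m) :
  tvec A := tvec_of i p (delta_mx 0 j).

(* The natural charts (x, y) of the tangent bundle TM. *)
Definition TM (M : Type) n (A : atlas M n) : Type := (M * tvec A)%type.

Definition TM_atlas M n (A : atlas M n) : atlas (TM A) (n + n) := {|
  idx := idx A;
  dom := fun i => [set u | dom i u.1 /\ tangent u.1 u.2];
  crd := fun i u => row_mx (crd i u.1) (u.2 i);
  par := fun i z => (par i (lsubmx z), tvec_of i (par i (lsubmx z)) (rsubmx z))
|}.

Definition slit M n (A : atlas M n) : set (TM A) :=
  [set u | tangent u.1 u.2 /\ u.2 != 0].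

(* Smoothness, around u, of real functions and of vector-valued ones; in the
   latter the vector s w is constrained to lie in the fibre [fib w], and E is
   the type of its components.  Only the values near u matter. *)
Definition smooth_fun T m (A : atlas T m) (f : T -> R) (u : T) : Prop :=
  forall i : idx A, dom i u -> smooth_near (fun z => f (par i z)) (crd i u).

Definition smooth_section T m (A : atlas T m) k
    (fib : T -> set (idx A -> 'rV[R]_k)) (s : T -> idx A -> 'rV[R]_k) (u : T) :=
  forall i : idx A, dom i u ->
    (\forall z \near crd i u, fib (par i z) (s (par i z))) /\
    smooth_near (fun z => s (par i z) i) (crd i u).

(* Derivative of f at u along the tangent vector X, computed in the chart i. *)
Definition act T m (A : atlas T m) (i : idx A) (u : T) (X : tvec A)
  (f : T -> R) : R := 'd (fun z => f (par i z)) (crd i u) (X i).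

Definition lie_bracket T m (A : atlas T m) (X Y : T -> tvec A) (u : T) :
    tvec A := fun i =>
  if `[< dom i u >] then
    'd (fun z => Y (par i z) i) (crd i u) (X u i)
    - 'd (fun z => X (par i z) i) (crd i u) (Y u i)
  else 0.

End Manifolds.

Section PullbackBundle.
Context {R : realType} {M : topologicalType} {n : nat} (A : atlas (R := R) M n).

Notation TM := (TM A).
Notation TMA := (TM_atlas A).
Notation slit := (@slit R M n A).

(* The fibre of pi^{-1}(TM) over u is T_{pi(u)} M. *)
Definition pi_fib (u : TM) : set (tvec A) := tangent u.1.

Definition smooth_pi_field (X : TM -> tvec A) (u : TM) : Prop :=
  smooth_section (A := TMA) pi_fib X u.

Definition smooth_field (X : TM -> tvec TMA) (u : TM) : Prop :=
  smooth_section (A := TMA) (@tangent R _ _ TMA) X u.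

Definition pi_vector_field (X : TM -> tvec A) : Prop :=
  forall u, slit u -> pi_fib u (X u) /\ smooth_pi_field X u.

(* rho and gamma in the natural coordinates, where d(pi)(xdot, ydot) = xdot
   and the vertical lift of v is (0, v). *)
Definition rho (X : tvec TMA) : tvec A := fun i => lsubmx (X i).
Definition gamma (v : tvec A) : tvec TMA := fun i => row_mx 0 (v i).

Definition eta (u : TM) : tvec A := u.2.

(* A covariant derivative, D u X zeta being the derivative at u of the local
   section zeta along the vector X of T_u. *)
Definition cov := TM -> tvec TMA -> (TM -> tvec A) -> tvec A.

Record linear_connection (D : cov) : Prop := {
  cov_fib : forall u X zeta, slit u -> tangent u X -> smooth_pi_field zeta u ->
    pi_fib u (D u X zeta);
  cov_linear : forall u (a : R) X Y zeta, slit u -> tangent u X ->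
    tangent u Y -> smooth_pi_field zeta u ->
    D u (a *: X + Y) zeta = a *: D u X zeta + D u Y zeta;
  cov_add : forall u X zeta xi, slit u -> tangent u X ->
    smooth_pi_field zeta u -> smooth_pi_field xi u ->
    D u X (fun w => zeta w + xi w) = D u X zeta + D u X xi;
  cov_leibniz : forall u X (f : TM -> R) zeta (i : idx TMA), slit u ->
    dom i u -> tangent u X ->
    smooth_fun TMA f u -> smooth_pi_field zeta u ->
    D u X (fun w => f w *: zeta w) = act i u X f *: zeta u + f u *: D u X zeta;
  cov_smooth : forall u X zeta, slit u -> smooth_field X u ->
    smooth_pi_field zeta u -> smooth_pi_field (fun w => D w (X w) zeta) u }.

Definition vertical (u : TM) : set (tvec TMA) :=
  [set X | tangent u X /\ rho X = 0].

Definition connection_map (D : cov) (u : TM) (X : tvec TMA) : tvec A :=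
  D u X eta.

Definition horizontal (D : cov) (u : TM) : set (tvec TMA) :=
  [set X | tangent u X /\ connection_map D u X = 0].

Definition regular (D : cov) : Prop :=
  forall u, slit u ->
    vertical u `&` horizontal D u = [set 0] /\
    (forall X, tangent u X ->
       exists Y Z, [/\ vertical u Y, horizontal D u Z & X = Y + Z]).

(* The inverse of rho on the kernel of the connection map. *)
Definition beta (D : cov) (u : TM) (v : tvec A) : tvec TMA :=
  xget 0 [set X | horizontal D u X /\ rho X = v].

Definition torsion (D : cov) (X Y : TM -> tvec TMA) (u : TM) : tvec A :=
  D u (X u) (fun w => rho (Y w)) - D u (Y u) (fun w => rho (X w))
  - rho (lie_bracket X Y u).

Definition hh_torsion (D : cov) (X Y : TM -> tvec A) : TM -> tvec A :=
  torsion D (fun w => beta D w (X w)) (fun w => beta D w (Y w)).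

Definition vh_torsion (D : cov) (X Y : TM -> tvec A) : TM -> tvec A :=
  torsion D (fun w => gamma (X w)) (fun w => beta D w (Y w)).

(* (1/2) d^2/ds dt L^2(u + s v + t w) at s = t = 0, that is
   (1/2) (d^2 L^2 / dy^i dy^j) v^i w^j. *)
Definition finsler_metric (L : TM -> R) (u : TM) (v w : tvec A) : R :=
  2^-1 * derive1 (fun s : R =>
    derive1 (fun t : R => L (u.1, u.2 + s *: v + t *: w) ^+ 2) 0) 0.

(* Nondegeneracy of the metric; it is positive definite as a consequence. *)
Record finsler_structure (L : TM -> R) : Prop := {
  fins_zero : forall p, L (p, 0) = 0;
  fins_pos : forall u, slit u -> 0 < L u;
  fins_continuous : forall (i : idx TMA) z, rng i z ->
    {for z, continuous (fun z => L (par i z))};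
  fins_smooth : forall u, slit u -> smooth_fun TMA L u;
  fins_homogeneous : forall u (t : R), slit u -> 0 < t ->
    L (u.1, t *: u.2) = t * L u;
  fins_nondegenerate : forall u v, slit u -> pi_fib u v ->
    (forall w, pi_fib u w -> finsler_metric L u v w = 0) -> v = 0 }.

Record cartan_connection (L : TM -> R) (D : cov) : Prop := {
  cartan_linear : linear_connection D;
  cartan_regular : regular D;
  cartan_metric : forall u X Y Z (i : idx TMA), slit u -> dom i u ->
    tangent u X -> smooth_pi_field Y u -> smooth_pi_field Z u ->
    act i u X (fun w => finsler_metric L w (Y w) (Z w)) =
    finsler_metric L u (D u X Y) (Z u) + finsler_metric L u (Y u) (D u X Z);
  cartan_hh : forall u X Y, slit u ->
    smooth_pi_field X u -> smooth_pi_field Y u -> hh_torsion D X Y u = 0;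
  cartan_vh : forall u X Y Z, slit u ->
    smooth_pi_field X u -> smooth_pi_field Y u -> smooth_pi_field Z u ->
    finsler_metric L u (vh_torsion D X Y u) (Z u) =
    finsler_metric L u (vh_torsion D X Z u) (Y u) }.

Record concurrent (D : cov) (zeta : TM -> tvec A) : Prop := {
  conc_field : pi_vector_field zeta;
  conc_horizontal : forall u v, slit u -> pi_fib u v ->
    D u (beta D u v) zeta = - v;
  conc_vertical : forall u v, slit u -> pi_fib u v -> D u (gamma v) zeta = 0 }.

(* For n >= 2 the admissible directions y, y' are all the nonzero ones.  For
   n = 1 the fibres of the slit tangent bundle are disconnected and sections
   over their two halves are unrelated, so that not depending on y is meant on
   each component. *)
Definition y_independent (F : forall i : idx A, TM -> 'rV[R]_n) : Prop :=
  forall (i : idx A) (x y y' : 'rV[R]_n), rng i x -> y != 0 -> y' != 0 ->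
    ((1 < n)%N \/ connected_component [set v : 'rV[R]_n | v != 0] y y') ->
    F i (@par _ _ _ TMA i (row_mx x y)) =
    F i (@par _ _ _ TMA i (row_mx x y')).

Definition pi_field_y_independent (X : TM -> tvec A) : Prop :=
  y_independent (fun i u => X u i).

Definition pi_form_y_independent (alpha : TM -> tvec A -> R) : Prop :=
  y_independent (fun i u => \row_j alpha u (coord_vec i u.1 j)).

Definition associated_form (L : TM -> R) (zeta : TM -> tvec A) :
  TM -> tvec A -> R := fun u X => finsler_metric L u (zeta u) X.

End PullbackBundle.

(* Main.v *)
Require Import Defs.
From HB Require Import structures.
From mathcomp Require Import all_boot all_order all_algebra.
From mathcomp Require Import all_classical all_reals all_analysis.
From mathcomp Require Import ring.

Set Implicit Arguments.
Unset Strict Implicit.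
Unset Printing Implicit Defensive.

Import Order.TTheory GRing.Theory Num.Theory numFieldNormedType.Exports.
Local Open Scope classical_set_scope.
Local Open Scope ring_scope.

(** Write [g] for the metric, [zeta] for the concurrent field and
    [alpha = g(zeta, -)].

    The form comes first.  The connection is metric, so the derivative of the
    function [g(zeta, zeta)] along [X] is [2 g(D_X zeta, zeta)].  It vanishes for
    vertical [X], because vertical covariant derivatives of [zeta] vanish; hence
    [g(zeta, zeta)] is the pullback of a function [F] of the base point, at least
    on each component of the fibres ([zeta_sqnorm_vertical], [vertical_cst]).
    For the horizontal lift of [a] it equals [- 2 alpha(a)].  But the derivative
    of a pullback only depends on the projection [a] of the lift, so
    [alpha = - dF / 2], and the right-hand side does not involve [y]
    ([zeta_sqnorm_horizontal], [form_y_indep]).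

    For the field, let [e_b] be the constant frame field [b] of a chart and [d_a]
    the vertical derivative in the direction [a].  Since [alpha(e_b)] does not
    depend on [y], metricity gives [g(zeta, D_a e_b) = 0] ([zeta_vcov]).  The
    horizontal part of the bracket of the vertical field [a] with the lift of
    [e_b] is zero, so that [D_a e_b] is the torsion [T(e_a, e_b)]
    ([vh_torsion_frames]), and the symmetry of [T] imposed on the Cartan
    connection reads [g(D_a e_b, e_c) = g(D_a e_c, e_b)] ([vcov_sym]).  Therefore
    [(d_a g)(e_c, e_b) = g(D_a e_c, e_b) + g(e_c, D_a e_b)] vanishes at a point
    where [e_c] takes the value [zeta] ([metric_vertical_zeta]): this is
    [C(a, b, zeta) = 0] for the Cartan tensor [C].  Differentiating
    [g(zeta, e_b) = alpha(e_b)] vertically now leaves [g(d_a zeta, e_b) = 0], and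
    [d_a zeta = 0] by nondegeneracy ([zeta_chart_vertical]).

    For two or more dimensions the nonzero vectors of a fibre form a connected
    set ([nonzero_vectors_connected]), and independence of [y] on components is
    independence of [y].

    The calculus behind this consists of the symmetry of second derivatives,
    which makes [g] symmetric ([derive_comm]), of the stability of smoothness
    under composition, which makes the constant frames smooth on the overlap
    with any other chart ([is_Ck_comp], [smooth_frame]), and of the local nature
    of covariant derivatives ([cov_local]). *)

(** * Differentials *)

Section Differentials.
Context {R : realType} {V W : normedModType R}.
Implicit Types (f g : V -> W) (x v : V).

(** The differential is a choice among the linear maps with the defining
    property; where there is none, the choice falls back on the zero map. *)
Lemma diff_not_differentiable f x : ~ differentiable f x -> 'd f x = \0 :> (V -> W).
Proof.
move=> nf; suff -> : 'd f x = point by [].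
apply: getPN => df H; apply: nf; apply/diffP.
by apply: (@getPex _ (fun df : {linear V -> W} => continuous df /\ forall y,
   f y = f (lim (nbhs x)) + df (y - lim (nbhs x))
     +o_(y \near x) (y - lim (nbhs x)))); exists df.
Qed.

Lemma near_eq_differentiable f g x : (\near x, f x = g x) ->
  differentiable f x -> differentiable g x /\ 'd g x = 'd f x :> (V -> W).
Proof.
move=> fg df; have gx : g x = f x by rewrite (nbhs_singleton fg).
have cdf : continuous ('d f x) by exact: diff_continuous.
have dg : g \o shift x = cst (g x) + 'd f x +o_ 0 id.
  apply/eqaddoP => e e0; have [_ /eqaddoP/(_ e e0) H] := (diff_locallyP x f).1 df.
  have := fg; rewrite (near_shift 0 x) subr0 => fg0.
  by apply: filterS2 fg0 H => y /= e1; rewrite !fctE /= gx -e1.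
have E := diff_unique cdf dg.
by split; [apply/diff_locallyP; rewrite E | exact: E].
Qed.

End Differentials.

Section DirectionalDerivatives.
Context {R : realType} {V W : normedModType R}.
Implicit Types (f g : V -> W) (x v : V).

Lemma near_eq_diff f g x : (\near x, f x = g x) -> 'd f x = 'd g x :> (V -> W).
Proof.
move=> fg; have gf : \near x, g x = f x by apply: filterS fg => y ->.
have [df|nf] := pselect (differentiable f x).
  by have [] := near_eq_differentiable fg df.
rewrite diff_not_differentiable// diff_not_differentiable// => dg.
by apply: nf; have [] := near_eq_differentiable gf dg.
Qed.

Lemma diff0P f x v : ('D_v f x = 0) -> 'd f x v = 0.
Proof.
move=> Df; have [df|nf] := pselect (differentiable f x); first by rewrite -deriveE.
by rewrite diff_not_differentiable.
Qed.

Lemma derive_line f x v : 'D_v f x = derive1 (fun t : R => f (x + t *: v)) 0.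
Proof.
rewrite /derive /derive1; set d := (fun _ : R => _); set d' := (fun _ : R => _).
suff -> : d = d' by []; apply/funext => h; rewrite /d /d' /=.
by rewrite addr0 scale0r addr0 (addrC x).
Qed.

Lemma derive_line_cst f x v :
  (\forall t \near (0 : R), f (x + t *: v) = f x) -> 'D_v f x = 0.
Proof.
move=> H; rewrite derive_line derive1E.
by rewrite (@near_eq_derive _ _ _ _ (cst (f x)))// derive_cst.
Qed.

Lemma derive_line_affine f x v (c : W) :
  (forall t : R, f (x + t *: v) = f x + t *: c) -> 'D_v f x = c.
Proof.
move=> H; rewrite derive_line.
have -> : (fun t : R => f (x + t *: v)) = cst (f x) + ( *:%R ^~ c).
  by apply/funext => t; rewrite H.
have [dg Eg] : is_diff (0 : R) (cst (f x) + ( *:%R ^~ c)) (0 + ( *:%R ^~ c)).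
  exact: is_diffD.
by rewrite (derive1E' dg) Eg !fctE add0r scale1r.
Qed.

Lemma is_derive_line f x v (t : R) : differentiable f (x + t *: v) ->
  is_derive t 1 (fun s : R => f (x + s *: v)) ('D_v f (x + t *: v)).
Proof.
move=> df; pose l := fun s : R => x + s *: v.
have dl : is_diff t l ( *:%R ^~ v).
  have -> : l = cst x + (fun s : R => s *: v) by [].
  by apply: is_diff_eq; rewrite add0r.
have dl' : differentiable l t by case: dl.
have dfl : differentiable (f \o l) t by exact: differentiable_comp.
split; first exact: diff_derivable.
rewrite -[LHS]/('D_1 (f \o l) t) deriveE// diff_comp//.
by rewrite /= diff_val scale1r deriveE.
Qed.

(** Sums that agree with [f] only near [x] come from expansions in a frame, valid
    on the domain of a chart. *)
Lemma derive_near_sum m (h : 'I_m -> V -> W) f x v :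
  (forall k, differentiable (h k) x) ->
  (\forall z \near x, \sum_k h k z = f z) ->
  differentiable f x /\ 'D_v f x = \sum_k 'D_v (h k) x.
Proof.
move=> dh E; have E' : \forall z \near x, (\sum_k h k) z = f z.
  by apply: filterS E => z; rewrite fct_sumE.
split; first exact: (near_eq_differentiable E' (differentiable_sum dh)).1.
rewrite -(near_eq_derive v E'); apply: derive_sum => k; exact: diff_derivable.
Qed.

End DirectionalDerivatives.

Section ScaleBilinear.
Context {R : realType} {W : normedModType R}.

Lemma scale_is_bilinear :
  bilinear_for
    (GRing.Scale.Law.clone _ _ *:%R _) (GRing.Scale.Law.clone _ _ *:%R _)
    (@GRing.scale R W).
Proof.
split=> [u'|u] a x y /=; first by rewrite scalerDl scalerA.
by rewrite scalerDr !scalerA mulrC.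
Qed.
HB.instance Definition _ :=
  bilinear_isBilinear.Build R R W W _ _ (@GRing.scale R W) scale_is_bilinear.

Lemma derive_scale (V : normedModType R) (f : V -> R) (g : V -> W) x v :
  differentiable f x -> differentiable g x ->
  differentiable (fun z => f z *: g z) x /\
  'D_v (fun z => f z *: g z) x = 'D_v f x *: g x + f x *: 'D_v g x.
Proof.
move=> df dg; pose s := fun p : R * W => p.1 *: p.2.
have cs : continuous s by move=> p; exact: scale_continuous.
have ds p : differentiable s p by exact: (differentiable_bilin (f := @GRing.scale R W)).
have dp := differentiable_pair df dg.
have dfg : differentiable (s \o (fun z => (f z, g z))) x by exact: differentiable_comp.
split; first exact: dfg.
rewrite -[LHS]/('D_v (s \o (fun z => (f z, g z))) x) deriveE// diff_comp//= diff_pair//.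
by rewrite (diff_bilin (f := @GRing.scale R W))//= -!deriveE// addrC.
Qed.

End ScaleBilinear.

Section LinearRowMaps.
Context {R : realType} {W : normedModType R} {m : nat}.

Lemma linear_rV_continuous (l : {linear 'rV[R]_m -> W}) : continuous l.
Proof.
have -> : (l : _ -> _) = \sum_j (fun v : 'rV_m => v 0 j *: l (delta_mx 0 j)).
  apply/funext => v; rewrite fct_sumE {1}(row_sum_delta v) linear_sum.
  by apply: eq_bigr => j _; rewrite linearZ.
move=> v; apply/differentiable_continuous/differentiable_sum => j.
by apply: differentiableZl; exact: differentiable_coord.
Qed.

Lemma diff_linear (l : {linear 'rV[R]_m -> W}) x :
  differentiable l x /\ 'd l x = l :> (_ -> _).
Proof.
have cl := @linear_rV_continuous l.
by split; [exact: linear_differentiable | exact: diff_lin].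
Qed.

Lemma diff_row_sum (f : 'rV[R]_m -> W) x v : differentiable f x ->
  'd f x v = \sum_j v 0 j *: 'D_(delta_mx 0 j) f x.
Proof.
move=> df; rewrite {1}(row_sum_delta v) linear_sum.
by apply: eq_bigr => j _; rewrite linearZ deriveE.
Qed.

End LinearRowMaps.

Definition row_coord {R : realType} {m} (j : 'I_m) (v : 'rV[R]_m) : R := v 0 j.

Lemma row_coord_is_linear {R : realType} {m} (j : 'I_m) :
  linear (@row_coord R m j).
Proof. by move=> a u v; rewrite /row_coord !mxE. Qed.
HB.instance Definition _ {R : realType} {m} (j : 'I_m) :=
  GRing.isLinear.Build R 'rV[R]_m R _ (@row_coord R m j)
    (@row_coord_is_linear R m j).

Lemma derive_row_coord {R : realType} {V : normedModType R} {m : nat}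
    (s : V -> 'rV[R]_m) z v (k : 'I_m) : differentiable s z ->
  differentiable (fun z => s z 0 k) z /\
  'D_v (fun z => s z 0 k) z = ('D_v s z) 0 k.
Proof.
move=> ds; have [dl El] := diff_linear (@row_coord R m k) (s z).
have d : differentiable (@row_coord R m k \o s) z by exact: differentiable_comp.
split; first exact: d.
apply: etrans (deriveE v d) _.
by rewrite diff_comp//= El deriveE.
Qed.

(** * Smooth maps *)

Section SmoothMaps.
Context {R : realType} {V : normedModType R}.
Implicit Types (O : set V).

Lemma near_open (T : topologicalType) (O : set T) (P : T -> Prop) a :
  open O -> O a -> (forall x, O x -> P x) -> \near a, P a.
Proof. by move=> oO Oa H; apply: filterS H _; exact: open_nbhs_nbhs. Qed.

Lemma is_Ck_ext (W : normedModType R) k O (f g : V -> W) :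
  open O -> (forall x, O x -> f x = g x) -> is_Ck k O f -> is_Ck k O g.
Proof.
elim: k f g => [|k IH] f g oO fg.
  move=> /= H x Ox; change (g @ x --> g x); rewrite -(fg x Ox).
  apply: cvg_trans (H x Ox); apply: near_eq_cvg.
  exact: (near_open oO Ox fg).
move=> [df H]; split.
  by move=> x Ox; have [] := near_eq_differentiable (near_open oO Ox fg) (df x Ox).
move=> v; apply: IH (H v) => // x Ox; apply: near_eq_derive.
exact: near_open oO Ox fg.
Qed.

Lemma is_Ck_sub (W : normedModType R) k O O' (f : V -> W) :
  O' `<=` O -> is_Ck k O f -> is_Ck k O' f.
Proof.
move=> sO; elim: k f => [|k IH] f /=; first by move=> H x /sO /H.
by move=> [df H]; split=> [x /sO /df//|v]; exact/IH/H.
Qed.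

Lemma is_Ck_local (W : normedModType R) k O (f : V -> W) :
  (forall x, O x -> exists N, [/\ open N, N x & is_Ck k N f]) -> is_Ck k O f.
Proof.
elim: k f => [|k IH] f H; first by move=> x /H[N [_ Nx C]]; exact: C.
split=> [x /H[N [_ Nx [df _]]]|v]; first exact: df.
by apply: IH => x /H[N [oN Nx [_ Hf]]]; exists N; split=> //; exact: Hf.
Qed.

Lemma is_CkW (W : normedModType R) k O (f : V -> W) : is_Ck k.+1 O f -> is_Ck k O f.
Proof.
elim: k f => [|k IH] f.
  by move=> [df _] x Ox; exact/differentiable_continuous/df.
by move=> [df H]; split=> // v; exact/IH/H.
Qed.

Lemma is_Ck_cst (W : normedModType R) k O (a : W) : is_Ck k O (cst a).
Proof.
elim: k a => [|k IH] a; first by move=> x _; exact: cvg_cst.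
split=> [//|v]; rewrite (_ : 'D_v (cst a) = cst 0) ?funeqE//.
by move=> x; rewrite derive_cst.
Qed.

Lemma is_CkD (W : normedModType R) k O (f g : V -> W) : open O ->
  is_Ck k O f -> is_Ck k O g -> is_Ck k O (f + g).
Proof.
move=> oO; elim: k f g => [|k IH] f g.
  by move=> Hf Hg x Ox; apply: cvgD; [exact: Hf|exact: Hg].
move=> [df Hf] [dg Hg]; split.
  by move=> x Ox; apply: differentiableD; [exact: df|exact: dg].
move=> v; apply: is_Ck_ext (IH _ _ (Hf v) (Hg v)) => // x Ox.
by rewrite deriveD//; apply: diff_derivable; [exact: df|exact: dg].
Qed.

Lemma is_Ck_sum (W : normedModType R) k O n (f : 'I_n -> V -> W) : open O ->
  (forall i, is_Ck k O (f i)) -> is_Ck k O (\sum_(i < n) f i).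
Proof.
move=> oO H; elim/big_ind : _ => //; first exact: is_Ck_cst.
by move=> g h; exact: is_CkD.
Qed.

Lemma is_CkZ (W : normedModType R) k O (f : V -> R) (g : V -> W) : open O ->
  is_Ck k O f -> is_Ck k O g -> is_Ck k O (fun z => f z *: g z).
Proof.
move=> oO; elim: k f g => [|k IH] f g.
  by move=> Hf Hg x Ox; apply: cvgZ; [exact: Hf|exact: Hg].
move=> Hf0 Hg0; have [df Hf] := Hf0; have [dg Hg] := Hg0; split.
  by move=> x Ox; have [] := derive_scale 0 (df x Ox) (dg x Ox).
move=> v; have H := is_CkD oO (IH _ _ (Hf v) (is_CkW Hg0)) (IH _ _ (is_CkW Hf0) (Hg v)).
apply: is_Ck_ext H => // x Ox.
by have [_ ->] := derive_scale v (df x Ox) (dg x Ox).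
Qed.

Lemma is_Ck_linl (W W' : normedModType R) k O (l : {linear W -> W'}) (f : V -> W) :
  open O -> continuous l -> is_Ck k O f -> is_Ck k O (l \o f).
Proof.
move=> oO cl; elim: k f => [|k IH] f.
  by move=> H x Ox; apply: continuous_comp; [exact: H|exact: cl].
move=> [df H]; split.
  move=> x Ox; apply: differentiable_comp; [exact: df|exact: linear_differentiable].
move=> v; apply: is_Ck_ext (IH _ (H v)) => // x Ox.
have dl := linear_differentiable (f x) cl.
rewrite deriveE; last exact/differentiable_comp/dl/df.
by rewrite diff_comp//=; [rewrite diff_lin// -deriveE//; exact: df|exact: df].
Qed.

End SmoothMaps.

Lemma is_Ck_linear {R : realType} {W : normedModType R} {m : nat} k
  (O : set 'rV[R]_m) (l : {linear 'rV[R]_m -> W}) : is_Ck k O l.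
Proof.
case: k => [x _|k]; first exact: linear_rV_continuous.
split=> [x _|v]; first exact: (diff_linear l x).1.
have -> : 'D_v l = cst (l v); last exact: is_Ck_cst.
by apply/funext => x; have [dl El] := diff_linear l x; rewrite deriveE// El.
Qed.

Section SmoothComposition.
Context {R : realType} {V W : normedModType R} {m : nat}.

Lemma is_Ck_coord k (O : set V) (g : V -> 'rV[R]_m) j : open O ->
  is_Ck k O g -> is_Ck k O (fun x => g x 0 j).
Proof.
move=> oO; apply: (is_Ck_linl (l := @row_coord R m j)) => //.
exact: linear_rV_continuous.
Qed.

(** The chain rule expresses the derivatives of [f \o g] as sums of products of
    coordinates of derivatives of [g] and of composites of derivatives of [f]
    with [g], so that the order of smoothness of composites can be raised by
    induction. *)
Lemma is_Ck_comp k (O : set V) (O' : set 'rV[R]_m) (g : V -> 'rV[R]_m)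
    (f : 'rV[R]_m -> W) : open O -> open O' -> (forall x, O x -> O' (g x)) ->
  is_Ck k O g -> is_Ck k O' f -> is_Ck k O (f \o g).
Proof.
move=> oO oO' gO; elim: k f => [|k IH] f Hg Hf.
  by move=> x Ox; apply: continuous_comp; [exact: Hg|exact/Hf/gO].
have Hgk := is_CkW Hg; case: Hg => dg Hg; case: Hf => df Hf; split.
  by move=> x Ox; apply: differentiable_comp; [exact: dg|exact/df/gO].
move=> v.
have H : is_Ck k O (\sum_j (fun x => ('D_v g x) 0 j *: ('D_(delta_mx 0 j) f \o g) x)).
  apply: is_Ck_sum => // j; apply: is_CkZ => //; first exact/is_Ck_coord/Hg.
  exact: IH Hgk (Hf _).
apply: is_Ck_ext H => // x Ox.
have [dgx dfx] := (dg x Ox, df _ (gO x Ox)).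
have -> : 'D_v (f \o g) x = 'd f (g x) ('D_v g x).
  by rewrite deriveE; [rewrite diff_comp//= -(deriveE v dgx)|exact: differentiable_comp].
by rewrite diff_row_sum// fct_sumE.
Qed.

End SmoothComposition.

(** * Symmetry of second derivatives *)

Section Schwarz.
Context {R : realType} {V : normedModType R}.
Implicit Types (f : V -> R) (x v w : V).

Lemma mean_value_from0 (F dF : R -> R) (h : R) : 0 <= h ->
  (forall s : R, 0 <= s <= h -> is_derive s 1 F (dF s)) ->
  exists2 c, 0 <= c <= h & F h - F 0 = dF c * h.
Proof.
move=> h0 H; have [||c] := @MVT_segment R F dF 0 h h0.
- by move=> s /[!in_itv]/= /andP[s0 sh]; apply: H; rewrite !ltW.
- by apply: derivable_within_continuous => s /[!in_itv]/= /H [].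
- by rewrite in_itv /= => ch; rewrite subr0 => E; exists c.
Qed.

(** The mean value theorem is applied twice: in the direction [v] to the
    increment of [f] along [h *: w], then in the direction [w]. *)
Lemma second_difference f (O : set V) x v w (h : R) : 0 <= h -> is_Ck 2 O f ->
  (forall s t : R, 0 <= s <= h -> 0 <= t <= h -> O (x + s *: v + t *: w)) ->
  exists s t, [/\ 0 <= s <= h, 0 <= t <= h &
    f (x + h *: v + h *: w) - f (x + h *: v) - f (x + h *: w) + f x =
    'D_w ('D_v f) (x + s *: v + t *: w) * h * h].
Proof.
move=> h0 [df /(_ v) [ddf _]] H; have hh : 0 <= h <= h by rewrite h0 lexx.
have zh : 0 <= (0 : R) <= h by rewrite lexx h0.
have [s|s sh E] := @mean_value_from0 (fun s => f (x + h *: w + s *: v) - f (x + s *: v))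
  (fun s => 'D_v f (x + h *: w + s *: v) - 'D_v f (x + s *: v)) h h0.
  move=> sh; apply: is_deriveB; apply: is_derive_line; apply: df.
    by rewrite addrAC; exact: H.
  by have := H s 0 sh zh; rewrite scale0r addr0.
have [t|t th E'] := @mean_value_from0 (fun t => 'D_v f (x + s *: v + t *: w))
  (fun t => 'D_w ('D_v f) (x + s *: v + t *: w)) h h0.
  by move=> th; apply: is_derive_line; apply: ddf; exact: H.
exists s, t; split=> //; move: E E'; rewrite !scale0r !addr0 => E <-.
rewrite [x + s *: v + _]addrAC -E [x + h *: w + _]addrAC; ring.
Qed.

Lemma no_common_value (a b p q : R) :
  `|a - p| < `|a - b| / 2 -> `|b - q| < `|a - b| / 2 -> p = q -> False.
Proof.
move=> Ha Hb pq; have := ltrD Ha Hb; rewrite pq (distrC b) -splitr.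
by move/(le_lt_trans (ler_distD _ _ _)); rewrite ltxx.
Qed.

(** The second difference of [second_difference] is symmetric in [v] and [w], so
    the two mixed derivatives share values at points arbitrarily close to [x];
    they agree at [x] by continuity. *)
Lemma derive_comm f (O : set V) x v w : open O -> O x -> is_Ck 2 O f ->
  'D_v ('D_w f) x = 'D_w ('D_v f) x.
Proof.
move=> oO Ox Cf; apply/eqP; rewrite -subr_eq0 -normr_eq0; apply/negPn/negP => ne.
set A := 'D_v ('D_w f); set B := 'D_w ('D_v f).
pose e := `|A x - B x| / 2.
have e0 : 0 < e by rewrite divr_gt0// lt0r ne normr_ge0.
have cA : {for x, continuous A} by have [_ /(_ w) [_ /(_ v) /(_ x Ox)]] := Cf.
have cB : {for x, continuous B} by have [_ /(_ v) [_ /(_ w) /(_ x Ox)]] := Cf.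
have /nbhs_ballP[d /= d0 Hd] : \forall y \near x,
    [/\ O y, `|A x - A y| < e & `|B x - B y| < e].
  have near_lt (g : V -> R) : {for x, continuous g} ->
      nbhs x [set y | `|g x - g y| < e] by move=> /cvgrPdist_lt; exact.
  have nA := near_lt A cA; have nB := near_lt B cB.
  have nO : nbhs x O by exact: open_nbhs_nbhs.
  have nAB : nbhs x (O `&` ([set y | `|A x - A y| < e] `&` [set y | `|B x - B y| < e])).
    exact: filterI nO (filterI nA nB).
  by apply: filterS nAB => y [Oy [Ay By]]; exact: And3 Oy Ay By.
(* This [h] keeps [s *: v + t *: w] of norm less than [d] for [s, t <= h]; the
   summand 1 makes [c] positive when [v = w = 0]. *)
pose c := `|v| + `|w| + 1; pose h := d / (2 * c).
have c0 : 0 < c by rewrite /c ltr_wpDl// addr_ge0.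
have h0 : 0 < h by rewrite /h divr_gt0// mulr_gt0.
have ballh s t : 0 <= s <= h -> 0 <= t <= h -> ball x d (x + s *: v + t *: w).
  move=> /andP[s0 sh] /andP[t0 th].
  rewrite -ball_normE /= -addrA opprD addrA subrr add0r normrN.
  rewrite (le_lt_trans (ler_normD _ _))// !normrZ !ger0_norm//.
  apply: (@le_lt_trans _ _ (h * (`|v| + `|w|))).
    by rewrite mulrDr lerD// ler_wpM2r.
  apply: (@lt_trans _ _ (h * c)); first by rewrite ltr_pM2l// ltrDl.
  have -> : h * c = d / 2 by rewrite /h; field; rewrite lt0r_neq0.
  by rewrite ltr_pdivrMr// ltr_pMr// ltr1n.
have [s [t [sh th E]]] := @second_difference f O x v w h (ltW h0) Cf
  (fun s t sh th => let: And3 H _ _ := Hd _ (ballh s t sh th) in H).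
have ballh' s' t' : 0 <= s' <= h -> 0 <= t' <= h -> ball x d (x + s' *: w + t' *: v).
  by move=> s'h t'h; rewrite addrAC; exact: ballh.
have [s' [t' [sh' th' E']]] := @second_difference f O x w v h (ltW h0) Cf
  (fun s t sh th => let: And3 H _ _ := Hd _ (ballh' s t sh th) in H).
have [_ _ Hb] := Hd _ (ballh _ _ sh th).
have [_ Ha _] := Hd _ (ballh' _ _ sh' th').
have EAB : A (x + s' *: w + t' *: v) = B (x + s *: v + t *: w).
  apply: (mulIf (lt0r_neq0 h0)); apply: (mulIf (lt0r_neq0 h0)).
  apply: etrans (esym E') (etrans _ E).
  by rewrite [x + h *: w + _]addrAC; ring.
exact: (no_common_value Ha Hb EAB).
Qed.

End Schwarz.

(** * Functions with vanishing derivative *)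

Section LocallyConstant.
Context {R : realType}.

Lemma near_cst_of_derive0 (V : normedModType R) (f : V -> R) (O : set V) x :
  open O -> O x ->
  (forall y v (t : R), O (y + t *: v) ->
     is_derive t 1 (fun s : R => f (y + s *: v)) 0) ->
  \forall y \near x, f y = f x.
Proof.
move=> oO Ox df; have /nbhs_ballP[e /= e0 He] : nbhs x O by exact: open_nbhs_nbhs.
apply/nbhs_ballP; exists e => // y xy.
have Ol (t : R) : 0 <= t <= 1 -> O (x + t *: (y - x)).
  move=> /andP[t0 t1]; apply: He; rewrite -ball_normE /= opprD addrA subrr.
  rewrite add0r normrN normrZ ger0_norm// (le_lt_trans (ler_piMl _ _))//.
  by move: xy; rewrite -ball_normE /= distrC.
have [t Ht|t Ht] := @mean_value_from0 R (fun t => f (x + t *: (y - x))) (cst 0) 1 ler01.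
  exact/df/Ol.
rewrite /= mul0r scale1r scale0r addr0 subrKC => /eqP.
by rewrite subr_eq0 => /eqP.
Qed.

(** The points where [F] takes the value [F y] form an open and closed part of
    the component. *)
Lemma cst_on_component (T : topologicalType) (U : Type) (S : set T) (F : T -> U) y y' :
  open S -> (forall v, S v -> \forall v' \near v, F v' = F v) ->
  connected_component S y y' -> F y = F y'.
Proof.
move=> oS H [C [Cy CS Cc] Cy'].
pose D := [set v | S v /\ F v = F y]; pose E := [set v | S v /\ F v <> F y].
have oD : open D.
  rewrite openE => v [Sv Fv]; apply: filterS2 (H v Sv) (open_nbhs_nbhs (conj oS Sv)).
  by move=> v' e1 Sv'; split=> //; rewrite e1.
have oE : open E.
  rewrite openE => v [Sv Fv]; apply: filterS2 (H v Sv) (open_nbhs_nbhs (conj oS Sv)).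
  by move=> v' e1 Sv'; split=> //; rewrite e1.
have CD : C `&` D = C.
  apply: Cc; first by exists y; split=> //; split=> //; exact: CS.
    by exists D.
  exists (~` E); first exact: open_closedC.
  apply/seteqP; split=> v [Cv Dv]; split=> //; first by move=> [_]; apply; case: Dv.
  by split; [exact: CS|apply: contrapT => nF; apply: Dv; split=> //; exact: CS].
by have [_ [_ ->]] : (C `&` D) y' by rewrite CD.
Qed.

Lemma segment_component (n : nat) (S : set 'rV[R]_n) y y' :
  (forall t : R, 0 <= t <= 1 -> S (y + t *: (y' - y))) -> connected_component S y y'.
Proof.
move=> H; pose l (t : R) := y + t *: (y' - y).
exists (l @` `[0, 1]); last first.
  by exists 1; rewrite /= ?in_itv/= ?lexx ?ler01// /l scale1r subrKC.
split.
- by exists 0; rewrite /= ?in_itv/= ?lexx ?ler01// /l scale0r addr0.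
- by move=> _ [t /= /[!in_itv]/= t01 <-]; exact: H.
- apply: connected_continuous_connected; first exact/connected_intervalP/interval_is_interval.
  apply: continuous_subspaceT => t; apply: cvgD; first exact: cvg_cst.
  exact: scalel_continuous.
Qed.

(** If [a k != 0] while [b k = 0] and [b != 0], the segment from [a] to [b] avoids
    the origin, since its [k]-th coordinate only vanishes at [b].  When [y] and
    [y'] both have a nonzero [i]-th coordinate, two such segments join them
    through a basis vector [e_j] with [j != i]. *)
Lemma nonzero_vectors_connected (n : nat) (y y' : 'rV[R]_n) : (1 < n)%N ->
  y != 0 -> y' != 0 -> connected_component [set v : 'rV[R]_n | v != 0] y y'.
Proof.
move=> n1 y0 y'0; have /rV0Pn[i yi] := y0.
have coordE (a b : 'rV[R]_n) (t : R) k : (a + t *: (b - a)) 0 k = (1 - t) * a 0 k + t * b 0 k.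
  by rewrite !mxE; ring.
have avoid (a b : 'rV[R]_n) k : b != 0 -> a 0 k != 0 -> b 0 k = 0 ->
    connected_component [set v : 'rV[R]_n | v != 0] a b.
  move=> b0 ak bk; apply: segment_component => t _; apply/eqP => E.
  have := coordE a b t k; rewrite E mxE bk mulr0 addr0 => /esym/eqP.
  rewrite mulf_eq0 (negbTE ak) orbF subr_eq0 => /eqP t1.
  by move: E; rewrite -t1 scale1r subrKC => /eqP; rewrite (negbTE b0).
have [y'i|y'i] := eqVneq (y' 0 i) 0; first exact: avoid yi y'i.
have [j ji] : exists j : 'I_n, j != i.
  have [->|i0] := eqVneq i (Ordinal (ltnW n1)); last by exists (Ordinal (ltnW n1)); rewrite eq_sym.
  by exists (Ordinal n1).
have ej0 : delta_mx 0 j != 0 :> 'rV[R]_n.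
  by apply/rV0Pn; exists j; rewrite mxE !eqxx oner_eq0.
have eji : (delta_mx 0 j : 'rV[R]_n) 0 i = 0 by rewrite mxE eqxx eq_sym (negbTE ji).
exact: connected_component_trans (avoid _ _ _ ej0 yi eji)
  (connected_component_sym (avoid _ _ _ ej0 y'i eji)).
Qed.

End LocallyConstant.

(** * Tangent vectors in charts *)

Section TangentSpaces.
Context {R : realType} {T : Type} {m : nat} {A : @atlas R T m}.

Lemma tangent_linear (p : T) (a : R) (v w : tvec A) :
  tangent p v -> tangent p w -> tangent p (a *: v + w).
Proof.
move=> [v0 vE] [w0 wE]; split=> [i ip|i j ip jp].
  by rewrite !fctE v0// w0// scaler0 addr0.
by rewrite !fctE (vE _ _ ip jp) (wE _ _ ip jp) linearP.
Qed.

Lemma tangent0 (p : T) : tangent p (0 : tvec A).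
Proof. by split=> // i j _ _; rewrite linear0. Qed.

End TangentSpaces.

Section Charts.
Context {R : realType} {M : topologicalType} {n : nat} {A : @atlas R M n}.
Context (hM : smooth_manifold A).
Implicit Types (i j k : idx A) (p : M).

Lemma rngE i x : rng i x -> dom i (par i x) /\ crd i (par i x) = x.
Proof. by move=> [p ip <-]; rewrite (mfd_crdK hM). Qed.

Lemma dom_rng i p : dom i p -> rng i (crd i p).
Proof. by exists p. Qed.

Definition overlap i j : set 'rV[R]_n := crd i @` (dom i `&` dom j).

Lemma overlapP i j x : overlap i j x <-> rng i x /\ dom j (par i x).
Proof.
split; last by move=> [/rngE[ix xE] jx]; exists (par i x).
by move=> [p [ip jp] <-]; rewrite (mfd_crdK hM)//; split=> //; exact: dom_rng.
Qed.

Lemma overlap_open i j : open (overlap i j).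
Proof.
rewrite openE => x /overlapP[ix jx].
have n1 : nbhs x (rng i) by apply: open_nbhs_nbhs; split=> //; exact: mfd_rng_open.
have n2 : nbhs x (par i @^-1` dom j).
  apply: (mfd_par_continuous hM ix); apply: open_nbhs_nbhs; split=> //.
  exact: mfd_dom_open.
by apply: filterS2 n1 n2 => y iy jy; apply/overlapP.
Qed.

Lemma overlap_crd i j p : dom i p -> dom j p -> overlap i j (crd i p).
Proof. by move=> ip jp; exists p. Qed.

Lemma transition_differentiable i j x : overlap i j x ->
  differentiable (transition i j) x.
Proof. by move=> ijx; have [H _] := mfd_transition hM i j 1; exact: H. Qed.

Lemma transition_crd i j p : dom i p -> transition i j (crd i p) = crd j p.
Proof. by move=> ip; rewrite /transition (mfd_crdK hM). Qed.

Lemma diff_transition_id i p y : dom i p -> 'd (transition i i) (crd i p) y = y.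
Proof.
move=> ip; have E : \forall x \near crd i p, transition i i x = id x.
  apply: (near_open (@mfd_rng_open _ _ _ _ hM i) (dom_rng ip)) => x /rngE[_ xE].
  by rewrite /transition xE.
by rewrite (near_eq_diff E) diff_val.
Qed.

(** The chain rule for changes of charts; it is what makes [tvec_of] produce
    tangent vectors. *)
Lemma diff_transition_cocycle i j k p y : dom i p -> dom j p -> dom k p ->
  'd (transition i k) (crd i p) y =
  'd (transition j k) (crd j p) ('d (transition i j) (crd i p) y).
Proof.
move=> ip jp kp.
have E : \forall x \near crd i p,
    transition i k x = (transition j k \o transition i j) x.
  apply: (near_open (@overlap_open i j) (overlap_crd ip jp)) => x [q [iq jq] <-].
  by rewrite /= !transition_crd.
have d1 : differentiable (transition i j) (crd i p).
  exact: transition_differentiable (overlap_crd ip jp).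
have d2 : differentiable (transition j k) (transition i j (crd i p)).
  by rewrite (transition_crd j ip); exact: transition_differentiable (overlap_crd jp kp).
rewrite -(transition_crd j ip).
exact: etrans (congr1 (@^~ y) (near_eq_diff E)) (congr1 (@^~ y) (diff_comp d1 d2)).
Qed.

Lemma tvec_ofE i j p y : dom j p ->
  tvec_of i p y j = 'd (transition i j) (crd i p) y.
Proof. by move=> jp; rewrite /tvec_of asboolT. Qed.

Lemma tvec_of_chart i p y : dom i p -> tvec_of i p y i = y.
Proof. by move=> ip; rewrite tvec_ofE//; exact: diff_transition_id. Qed.

Lemma tvec_of_tangent i p y : dom i p -> tangent p (tvec_of i p y).
Proof.
move=> ip; split=> [j jp|j k jp kp]; first by rewrite /tvec_of asboolF.
by rewrite (tvec_ofE _ _ jp) (tvec_ofE _ _ kp); exact: diff_transition_cocycle.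
Qed.

Lemma tvec_of_comp i p (v : tvec A) : dom i p -> tangent p v -> tvec_of i p (v i) = v.
Proof.
move=> ip [v0 vE]; apply/funext => j; have [jp|jp] := pselect (dom j p).
  by rewrite tvec_ofE// -vE.
by rewrite /tvec_of asboolF// v0.
Qed.

Notation TMA := (TM_atlas A).

(** The range of the natural chart [i] of the slit tangent bundle. *)
Definition tdom i : set 'rV[R]_(n + n) :=
  [set z | rng i (lsubmx z) /\ rsubmx z != 0].

Lemma lsubmx_preimage_open (O : set 'rV[R]_n) : open O ->
  open ((lsubmx : 'rV[R]_(n + n) -> _) @^-1` O).
Proof. by apply: open_comp => z _; exact: continuous_lsubmx. Qed.

Lemma nonzero_open m : open [set y : 'rV[R]_m | y != 0].
Proof.
have -> : [set y : 'rV[R]_m | y != 0] = ~` [set 0].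
  by apply/seteqP; split=> y /=; [move/eqP|move=> ?; exact/eqP].
apply: closed_openC; apply: accessible_closed_set1.
exact: hausdorff_accessible (@norm_hausdorff _ _).
Qed.

Lemma tdom_open i : open (tdom i).
Proof.
have -> : tdom i = (lsubmx @^-1` rng i) `&` (rsubmx @^-1` [set y | y != 0]) by [].
apply: openI; first exact/lsubmx_preimage_open/mfd_rng_open.
by apply: open_comp (@nonzero_open n) => z _; exact: continuous_rsubmx.
Qed.

Lemma TM_dom_par i z : rng i (lsubmx z) -> @dom _ _ _ TMA i (par (i : idx TMA) z).
Proof. by move=> /rngE[ix _]; split=> //=; exact: tvec_of_tangent. Qed.

Lemma TM_crd_par i z : rng i (lsubmx z) -> crd (i : idx TMA) (par (i : idx TMA) z) = z.
Proof. by move=> /rngE[ix xE] /=; rewrite xE tvec_of_chart// hsubmxK. Qed.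

Lemma TM_par_crd i u : @dom _ _ _ TMA i u -> par (i : idx TMA) (crd (i : idx TMA) u) = u.
Proof.
case: u => p v [/= ip tv]; rewrite row_mxKl row_mxKr (mfd_crdK hM)//.
by rewrite tvec_of_comp.
Qed.

Lemma TM_dom i u : slit u -> dom i u.1 -> @dom _ _ _ TMA i u.
Proof. by move=> [tu _] iu; split. Qed.

Lemma TM_crd_tdom i u : slit u -> dom i u.1 -> tdom i (crd (i : idx TMA) u).
Proof.
move=> [tu u0] iu; split; rewrite /= ?row_mxKl ?row_mxKr; first exact: dom_rng.
apply: contraNN u0 => /eqP ui0; apply/eqP/funext => j.
have [ju|/tu.1//] := pselect (dom j u.1).
by rewrite (tu.2 _ _ iu ju) ui0 linear0.
Qed.

Lemma slit_par i z : tdom i z -> slit (par (i : idx TMA) z).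
Proof.
move=> [iz z0]; split; first exact: (TM_dom_par iz).2.
apply: contraNN z0 => /eqP v0; have /(_ (rsubmx z)) := tvec_of_chart _ (rngE iz).1.
by move: v0 => /= -> <-.
Qed.

Lemma lsubmx_vert (z : 'rV[R]_(n + n)) (t : R) w :
  lsubmx (z + t *: row_mx 0 w) = lsubmx z.
Proof. by rewrite linearD linearZ /= row_mxKl scaler0 addr0. Qed.

Lemma rsubmx_vert (z : 'rV[R]_(n + n)) (t : R) w :
  rsubmx (z + t *: row_mx 0 w) = rsubmx z + t *: w.
Proof. by rewrite linearD linearZ /= row_mxKr. Qed.

(** The natural charts are related by [(x, y) |-> (phi x, 'd phi x y)], which is
    affine along the fibres: moving [(x, y)] in the direction [(0, w)] only
    changes ['d phi x y], by ['d phi x w].  Differentiability, without which the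
    differential would not compute this directional derivative, comes from
    expanding ['d phi x y] in the partial derivatives of [phi]. *)
Lemma diff_TM_transition i j u w : slit u -> dom i u.1 -> dom j u.1 ->
  'd (transition (i : idx TMA) (j : idx TMA)) (crd (i : idx TMA) u) (row_mx 0 w) =
  row_mx 0 ('d (transition i j) (crd i u.1) w).
Proof.
move=> su iu ju; set z := crd _ u; pose phi := transition i j.
pose O := (lsubmx : 'rV[R]_(n + n) -> _) @^-1` overlap i j.
have oO : open O := lsubmx_preimage_open (@overlap_open i j).
have Oz : O z by rewrite /O /= row_mxKl; exact: overlap_crd.
pose F := fun z : 'rV[R]_(n + n) =>
  row_mx (phi (lsubmx z)) ('d phi (lsubmx z) (rsubmx z)).
have EF : \near z, transition (i : idx TMA) (j : idx TMA) z = F z.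
  apply: (near_open oO Oz) => t /overlapP[it jt].
  have [_ tE] := rngE it; have := tvec_ofE i (rsubmx t) jt; rewrite tE => tj.
  by rewrite /F -tj.
rewrite (near_eq_diff EF).
have dF : differentiable F z.
  have Clsub : is_Ck 1 O (lsubmx : 'rV[R]_(n + n) -> 'rV[R]_n).
    exact: is_Ck_linear.
  have Crsub : is_Ck 1 O (rsubmx : 'rV[R]_(n + n) -> 'rV[R]_n).
    exact: is_Ck_linear.
  have inO t : O t -> overlap i j (lsubmx t) by [].
  have Cphi (r : nat) : is_Ck r (overlap i j) phi by exact: mfd_transition.
  (* [P a = row_mx a 0] and [Q b = row_mx 0 b]. *)
  pose P : {linear 'rV[R]_n -> 'rV[R]_(n + n)} := mulmxr (row_mx 1%:M 0).
  pose Q : {linear 'rV[R]_n -> 'rV[R]_(n + n)} := mulmxr (row_mx 0 1%:M).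
  pose D := \sum_k (fun t : 'rV[R]_(n + n) =>
    (rsubmx t) 0 k *: ('D_(delta_mx 0 k) phi \o lsubmx) t).
  have C1 : is_Ck 1 O (P \o (phi \o lsubmx)).
    apply: (is_Ck_linl oO (@linear_rV_continuous _ _ _ P)).
    exact: is_Ck_comp oO (@overlap_open i j) inO Clsub (Cphi 1%N).
  have C2 : is_Ck 1 O (Q \o D).
    apply: (is_Ck_linl oO (@linear_rV_continuous _ _ _ Q)).
    apply: (is_Ck_sum oO) => k; apply: (is_CkZ oO (is_Ck_coord k oO Crsub)).
    apply: (is_Ck_comp oO (@overlap_open i j) inO Clsub).
    by have [_ H] := Cphi 2%N; exact: H.
  have [dF _] : is_Ck 1 O F.
    apply: (is_Ck_ext _ _ (is_CkD oO C1 C2)) => // t Ot.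
    rewrite /F diff_row_sum; last exact/transition_differentiable/inO.
    rewrite /P /Q /D !fctE /= fct_sumE !mul_mx_row !mulmx1 !mulmx0 add_row_mx.
    by rewrite addr0 add0r.
  exact: dF.
rewrite -deriveE//; apply: derive_line_affine => t.
have -> : row_mx 0 ('d phi (crd i u.1) w) = row_mx 0 ('d phi (lsubmx z) w) :> 'rV_(n + n).
  by rewrite /z /= row_mxKl.
rewrite /F lsubmx_vert rsubmx_vert linearD linearZ /=.
by rewrite scale_row_mx scaler0 add_row_mx addr0.
Qed.

Lemma gamma_tangent u v : slit u -> pi_fib u v -> tangent (A := TMA) u (gamma v).
Proof.
move=> su tv; split=> [i iu|i j [iu _] [ju _]]; rewrite /gamma.
  by rewrite tv.1 ?row_mx0// => iu'; apply: iu; exact: TM_dom.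
by rewrite diff_TM_transition// -tv.2.
Qed.

Lemma smooth_pi_field0 u : smooth_pi_field (A := A) (fun=> 0) u.
Proof.
move=> i iu; have t0 z : setT z -> pi_fib (A := A) (par i z) 0 by move=> _; exact: tangent0.
split; first exact: near_open openT I t0.
by exists setT; split=> //; [exact: openT|move=> k; exact: is_Ck_cst].
Qed.

(** The constant frames of the charts are smooth: in the chart [j], the field
    [y] of the chart [i] is the composite of ['D_y (transition i j)] with
    [transition j i]. *)
Lemma smooth_frame i y u : @dom _ _ _ TMA i u ->
  smooth_pi_field (A := A) (fun w => tvec_of i w.1 y) u.
Proof.
move=> [iu tu] j; change (idx A) in (type of j); move=> [ju _].
pose O := (lsubmx : 'rV[R]_(n + n) -> _) @^-1` overlap j i.
have oO : open O := lsubmx_preimage_open (@overlap_open j i).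
have Ou : O (crd (j : idx TMA) u) by rewrite /O /= row_mxKl; exact: overlap_crd.
have tO z : O z -> pi_fib (par (j : idx TMA) z) (tvec_of i (par (j : idx TMA) z).1 y).
  by move=> /overlapP[_ iz]; exact: tvec_of_tangent.
split; first exact: near_open oO Ou tO.
exists O; split=> // k.
have in_overlap z : O z -> overlap i j (transition j i (lsubmx z)).
  by move=> /overlapP[jz iz]; have [jz' _] := rngE jz; exact: overlap_crd.
have Ctr : is_Ck k O (transition j i \o lsubmx).
  apply: (is_Ck_comp oO (@overlap_open j i)) => //; first exact: is_Ck_linear.
  exact: mfd_transition.
have H : is_Ck k O ('D_y (transition i j) \o (transition j i \o lsubmx)).
  apply: (is_Ck_comp oO (@overlap_open i j)) => //.
  by have [_ H] := mfd_transition hM i j k.+1; exact: H.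
refine (is_Ck_ext oO _ H) => z Oz.
have /overlapP[jz iz] := Oz; have [jz' zE] := rngE jz.
have d : differentiable (transition i j) (crd i (@par _ _ _ A j (lsubmx z))).
  exact/transition_differentiable/overlap_crd.
by rewrite [RHS](tvec_ofE _ _ jz') -(deriveE y d).
Qed.

End Charts.

(** * The metric in a chart *)

Section ChartMetric.
Context {R : realType} {M : topologicalType} {n : nat} {A : @atlas R M n}.
Context (hM : smooth_manifold A).
Notation TMA := (TM_atlas A).
Context {L : TM A -> R} (hL : finsler_structure L) (i : idx A).
Implicit Types (z : 'rV[R]_(n + n)) (a b c : 'rV[R]_n).

Local Notation U := (@tdom R M n A i).
Local Notation vert a := (row_mx (0 : 'rV[R]_n) a).

Definition sqL z : R := L (par (i : idx TMA) z) ^+ 2.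

(** The bilinear form with the coefficients
    [g_ij = (1/2) d^2 L^2 / dy^i dy^j] at the point of coordinates [z]. *)
Definition chart_metric z a b : R := 2^-1 * 'D_(vert a) ('D_(vert b) sqL) z.

Lemma finsler_metricE u v w : slit u -> dom i u.1 -> pi_fib u v -> pi_fib u w ->
  finsler_metric L u v w = chart_metric (crd (i : idx TMA) u) (v i) (w i).
Proof.
move=> [tu _] iu tv tw; rewrite /finsler_metric /chart_metric derive_line.
set z := crd _ u; suff E (r : R) :
    derive1 (fun t : R => L (u.1, u.2 + r *: v + t *: w) ^+ 2) 0 =
    'D_(vert (w i)) sqL (z + r *: vert (v i)).
  by have E' := funext E; rewrite -E'.
rewrite derive_line.
suff E (t : R) : L (u.1, u.2 + r *: v + t *: w) ^+ 2 =
    sqL (z + r *: vert (v i) + t *: vert (w i)).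
  by have E' := funext E; rewrite -E'.
rewrite /sqL.
have tr : tangent u.1 (u.2 + r *: v + t *: w).
  by rewrite addrC; apply: tangent_linear => //; rewrite addrC; exact: tangent_linear.
have := @TM_par_crd _ _ _ _ hM i (u.1, u.2 + r *: v + t *: w) (conj iu tr).
move=> <-; congr (L (par _ _) ^+ 2).
by rewrite /z /= !scale_row_mx !add_row_mx !scaler0 !addr0.
Qed.

Lemma sqL_Ck k : is_Ck k U sqL.
Proof.
have Lk : is_Ck k U (fun z => L (par (i : idx TMA) z)).
  apply: is_Ck_local => z Uz; have iz := Uz.1.
  have [N [oN Nz H]] := fins_smooth hL (slit_par hM Uz) (TM_dom_par hM iz).
  by exists N; split=> //; rewrite -(TM_crd_par hM iz).
by apply: is_Ck_ext (is_CkZ (tdom_open hM (i := i)) Lk Lk); first exact: tdom_open.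
Qed.

Lemma chart_metric_sym z a b : U z -> chart_metric z a b = chart_metric z b a.
Proof.
move=> Uz; have oU : open U := tdom_open hM (i := i).
have E := derive_comm (vert a) (vert b) oU Uz (sqL_Ck 2%N).
exact (congr1 (fun r : R => 2^-1 * r) E).
Qed.

Lemma chart_metric_linearl z (t : R) a a' b : U z ->
  chart_metric z (t *: a + a') b = t * chart_metric z a b + chart_metric z a' b.
Proof.
move=> Uz; have [_ /(_ (vert b)) [/(_ z Uz) dE _]] := sqL_Ck 2.
have E c := deriveE (vert c) dE.
rewrite /chart_metric (E (t *: a + a')) (E a) (E a').
have -> : vert (t *: a + a') = t *: vert a + vert a'.
  by rewrite scale_row_mx add_row_mx scaler0 addr0.
by rewrite linearD linearZ /= mulrDr [t * _]mulrCA.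
Qed.

Lemma chart_metric0l z b : U z -> chart_metric z 0 b = 0.
Proof.
by move=> Uz; have := chart_metric_linearl (-1) 0 0 b Uz; rewrite scaler0 addr0 mulN1r addNr.
Qed.

Lemma chart_metric_suml z a b : U z ->
  chart_metric z a b = \sum_k a 0 k * chart_metric z (delta_mx 0 k) b.
Proof.
move=> Uz; rewrite [in LHS](row_sum_delta a).
have P m (f : 'I_m -> R) (e : 'I_m -> 'rV[R]_n) :
    chart_metric z (\sum_k f k *: e k) b = \sum_k f k * chart_metric z (e k) b.
  elim: m f e => [|m IH] f e; first by rewrite !big_ord0 chart_metric0l.
  by rewrite !big_ord_recl chart_metric_linearl// IH.
exact: P.
Qed.

Lemma chart_metricNl z a b : U z -> chart_metric z (- a) b = - chart_metric z a b.
Proof.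
move=> Uz; rewrite -[- a]addr0 -scaleN1r chart_metric_linearl//.
by rewrite chart_metric0l// addr0 mulN1r.
Qed.

Lemma chart_metric_Ck k a b : is_Ck k U (fun z => chart_metric z a b).
Proof.
have oU := @tdom_open _ _ _ _ hM i.
have [_ /(_ (vert b)) [_ /(_ (vert a)) H]] := sqL_Ck k.+2.
exact (is_Ck_ext oU (fun _ _ => erefl) (is_CkZ oU (@is_Ck_cst R _ R k U 2^-1) H)).
Qed.

Lemma chart_metric_nondegenerate z a : U z -> (forall b, chart_metric z a b = 0) -> a = 0.
Proof.
move=> Uz H; have [/= iz zE] := rngE hM Uz.1; have su := slit_par hM Uz.
have ta := tvec_of_tangent hM a iz.
suff E : tvec_of i (par i (lsubmx z)) a = 0.
  by rewrite -(tvec_of_chart hM a iz) E.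
apply: (fins_nondegenerate hL su ta) => w tw.
by rewrite finsler_metricE// (TM_crd_par hM Uz.1) tvec_of_chart.
Qed.

(** The product rule: the derivative falls on the vector [s z] or on the metric.
    Both sides are expanded in the basis vectors, in which the metric has smooth
    coefficients. *)
Lemma contract_diff (s : 'rV[R]_(n + n) -> 'rV[R]_n) z v b : U z ->
  differentiable s z ->
  differentiable (fun z => chart_metric z (s z) b) z /\
  'D_v (fun z => chart_metric z (s z) b) z =
    chart_metric z ('D_v s z) b + 'D_v (fun z' => chart_metric z' (s z) b) z.
Proof.
move=> Uz ds; have oU := @tdom_open _ _ _ _ hM i.
pose e k : 'rV[R]_n := delta_mx 0 k.
have dg a : differentiable (fun z => chart_metric z a b) z.
  by have [dg _] := chart_metric_Ck 1 a b; exact: dg.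
have dk k := (derive_row_coord v k ds).1; have Dk k := (derive_row_coord v k ds).2.
pose h k z := s z 0 k *: chart_metric z (e k) b.
pose h' k z' := s z 0 k *: chart_metric z' (e k) b.
have dh k := derive_scale v (dk k) (dg (e k)).
have [df Df] := derive_near_sum v (h := h) (fun k => (dh k).1)
  (near_open oU Uz (fun z' Uz' => esym (chart_metric_suml (s z') b Uz'))).
have [_ Df'] := derive_near_sum v (h := h') (fun k => differentiableZ _ (dg (e k)))
  (near_open oU Uz (fun z' Uz' => esym (chart_metric_suml (s z) b Uz'))).
split; first exact: df.
apply: etrans Df _; apply: etrans (esym (congr1 ( +%R _) Df')).
rewrite (chart_metric_suml _ _ Uz) -big_split /=; apply: eq_bigr => k _.
apply: etrans (dh k).2 _; rewrite Dk; congr (_ + _).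
have Ez := deriveZ (s z 0 k) (diff_derivable (v := v) (dg (e k))).
exact (esym Ez).
Qed.

Lemma chart_metric_differentiable (s t : 'rV[R]_(n + n) -> 'rV[R]_n) z : U z ->
  differentiable s z -> differentiable t z ->
  differentiable (fun z => chart_metric z (s z) (t z)) z.
Proof.
move=> Uz ds dt; have oU := @tdom_open _ _ _ _ hM i.
pose h k z := t z 0 k *: chart_metric z (s z) (delta_mx 0 k).
apply: (derive_near_sum 0 (h := h) _ _).1 => [k|].
  apply: (derive_scale 0 _ _).1; first exact: (derive_row_coord 0 k dt).1.
  exact: (contract_diff 0 _ Uz ds).1.
have E z' : U z' -> \sum_k h k z' = chart_metric z' (s z') (t z').
  move=> Uz'; rewrite (chart_metric_sym _ _ Uz') (chart_metric_suml _ _ Uz').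
  by apply: eq_bigr => k _; rewrite /h (chart_metric_sym _ _ Uz').
exact: near_open oU Uz E.
Qed.

End ChartMetric.

(** * Vertical constancy *)

Section VerticalConstancy.
Context {R : realType} {M : topologicalType} {n : nat} {A : @atlas R M n}.
Context (hM : smooth_manifold A).
Context (i : idx A) (phi : 'rV[R]_(n + n) -> R).
Context (dphi : forall z, tdom i z -> differentiable phi z).

Local Notation vert a := (row_mx (0 : 'rV[R]_n) a).
Local Notation slit_vectors := [set v : 'rV[R]_n | v != 0].

Lemma tdom_row x y : rng i x -> y != 0 -> tdom i (row_mx x y).
Proof. by move=> ix y0; split; rewrite ?row_mxKl ?row_mxKr. Qed.

Lemma row_vert x y (t : R) w :
  row_mx x (y + t *: w) = row_mx x y + t *: vert w :> 'rV[R]_(n + n).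
Proof. by rewrite scale_row_mx add_row_mx scaler0 addr0. Qed.

Lemma vertical_cst x y y' :
  (forall z w, tdom i z -> 'd phi z (vert w) = 0) ->
  rng i x -> connected_component slit_vectors y y' ->
  phi (row_mx x y) = phi (row_mx x y').
Proof.
move=> d0 ix; pose F (y : 'rV[R]_n) := phi (row_mx x y).
apply: (cst_on_component (F := F) (@nonzero_open R n)) => v v0.
apply: (near_cst_of_derive0 (f := F) (@nonzero_open R n) v0) => w a t wt0.
have Uz : tdom i (row_mx x w + t *: vert a) by rewrite -row_vert; exact: tdom_row.
have E : (fun s : R => phi (row_mx x (w + s *: a))) =
    (fun s : R => phi (row_mx x w + s *: vert a)).
  by apply/funext => s; rewrite row_vert.
have H := is_derive_line (dphi Uz); rewrite (deriveE _ (dphi Uz)) d0// in H.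
by rewrite /F E.
Qed.

(** The two sides are derivatives along the parallel lines through [(x, y)] and
    [(x, y')] with direction [(a, 0)], on which [phi] takes the same values. *)
Lemma diff_horizontal_eq x y y' a : rng i x -> y != 0 -> y' != 0 ->
  (forall x', rng i x' -> phi (row_mx x' y) = phi (row_mx x' y')) ->
  'd phi (row_mx x y) (row_mx a 0) = 'd phi (row_mx x y') (row_mx a 0).
Proof.
move=> ix y0 y'0 E.
have dE v (v0 : v != 0) := deriveE (row_mx a 0) (dphi (tdom_row ix v0)).
apply: etrans (esym (dE y y0)) (etrans _ (dE y' y'0)).
rewrite (derive_line _ (row_mx x y)) (derive_line _ (row_mx x y')) !derive1E.
apply: near_eq_derive.
have rowE (t : R) v : row_mx x v + t *: row_mx a 0 = row_mx (x + t *: a) v.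
  by rewrite scale_row_mx add_row_mx scaler0 addr0.
have nrng : \forall t \near (0 : R), rng i (x + t *: a).
  have cl : {for (0 : R), continuous (fun t : R => x + t *: a)}.
    by apply: cvgD; [exact: cvg_cst|exact: scalel_continuous].
  apply: cl; rewrite scale0r addr0; apply: open_nbhs_nbhs; split=> //.
  exact: mfd_rng_open.
by apply: filterS nrng => t it; rewrite !rowE E.
Qed.

(** Small vertical displacements of [y] stay in its component. *)
Lemma diff_vertical0 x y w : rng i x -> y != 0 ->
  (forall y', connected_component slit_vectors y y' ->
     phi (row_mx x y') = phi (row_mx x y)) ->
  'd phi (row_mx x y) (vert w) = 0.
Proof.
move=> ix y0 E; apply: diff0P; apply: derive_line_cst.
have oS := @nonzero_open R n.
have /nbhs_ballP[e /= e0 He] : nbhs y slit_vectors by exact: open_nbhs_nbhs.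
have nball : \forall t \near (0 : R), ball y e (y + t *: w).
  have cl : {for (0 : R), continuous (fun t : R => y + t *: w)}.
    by apply: cvgD; [exact: cvg_cst|exact: scalel_continuous].
  by apply: cl; rewrite scale0r addr0; exact: nbhsx_ballx.
apply: filterS nball => t yt; rewrite -row_vert; apply: E.
apply: segment_component => s /andP[s0 s1]; apply: He.
have ballE v : ball y e (y + v) = (`|v| < e) :> Prop.
  by rewrite -ball_normE /= opprD addrA subrr add0r normrN.
rewrite ballE [_ - y]addrC addKr normrZ (ger0_norm s0); rewrite ballE in yt.
exact: le_lt_trans (ler_piMl (normr_ge0 _) s1) yt.
Qed.

End VerticalConstancy.

(** * Local properties of a linear connection *)

Section Connections.
Context {R : realType} {M : topologicalType} {n : nat} {A : @atlas R M n}.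
Context (hM : smooth_manifold A).
Notation TMA := (TM_atlas A).
Implicit Types (u w : TM A) (X : tvec TMA) (i j : idx A).

Lemma slit_chart_nbhs i j u : slit u -> dom i u.1 -> dom j u.1 ->
  exists O : set 'rV[R]_(n + n), [/\ open O, O (crd (j : idx TMA) u) &
    forall z, O z -> slit (par (j : idx TMA) z) /\ dom i (par (j : idx TMA) z).1].
Proof.
move=> su iu ju; exists (tdom j `&` (lsubmx @^-1` overlap j i)); split.
- apply: openI; first exact: tdom_open.
  by apply: lsubmx_preimage_open; exact: overlap_open.
- split; first exact: TM_crd_tdom.
  by rewrite /= row_mxKl; exact: overlap_crd.
- by move=> z [Uz /(overlapP hM)[_ iz]]; split=> //; exact: slit_par.
Qed.

Lemma smooth_pi_field_ext i u (X Y : TM A -> tvec A) : slit u -> dom i u.1 ->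
  (forall w, slit w -> dom i w.1 -> X w = Y w) ->
  smooth_pi_field X u -> smooth_pi_field Y u.
Proof.
move=> su iu E HX j ju; have [fX [N [oN Nz CX]]] := HX j ju.
have [N1 [oO Oz HO]] := slit_chart_nbhs su iu ju.1.
have EO z : N1 z -> X (par j z) = Y (par j z) by move=> /HO[sz iz]; exact: E.
split.
  have nO : nbhs (crd j u) N1 by exact: open_nbhs_nbhs.
  by apply: filterS (filterI nO fX) => z [Oz' fz]; rewrite -EO.
exists (N1 `&` N); split; [exact: openI|by []|move=> k].
have CXk : is_Ck k (N1 `&` N) (fun z => X (par j z) j).
  by apply: is_Ck_sub (CX k) => z [].
by refine (is_Ck_ext (openI oO oN) _ CXk) => z [Oz' _]; rewrite EO.
Qed.

Context (D : cov A).
Context (lD : linear_connection D).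

Lemma cov_zero u X : slit u -> tangent u X -> D u X (fun=> 0) = 0.
Proof.
move=> su tX; have s0 := @smooth_pi_field0 _ _ _ A u.
have := cov_add lD su tX s0 s0.
rewrite (_ : (fun w => 0 + 0) = fun=> 0); last by apply/funext => w; rewrite addr0.
by move=> H; apply: (addIr (D u X (fun=> 0))); rewrite add0r -H.
Qed.

Lemma cov_zero_vector u zeta : slit u -> smooth_pi_field zeta u -> D u 0 zeta = 0.
Proof.
move=> su sz; have t0 : tangent (A := TMA) u 0 by exact: tangent0.
by have := cov_linear lD (-1) su t0 t0 sz; rewrite scaler0 addr0 scaleN1r addNr.
Qed.

(** Leibniz' rule for the indicator of a neighbourhood of [u], which is smooth
    at [u], shows that the covariant derivative only depends on germs. *)
Lemma cov_local i u X (xi xi' : TM A -> tvec A) : slit u -> dom i u.1 ->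
  tangent u X -> smooth_pi_field xi u ->
  (forall w, slit w -> dom i w.1 -> xi w = xi' w) -> D u X xi = D u X xi'.
Proof.
move=> su iu tX sxi E; have sxi' := smooth_pi_field_ext su iu E sxi.
pose f w : R := if `[< slit w /\ dom i w.1 >] then 1 else 0.
have fE w : slit w -> dom i w.1 -> f w = 1 by move=> sw iw; rewrite /f asboolT.
have f1 j : dom j u.1 -> exists O : set 'rV[R]_(n + n),
    [/\ open O, O (crd (j : idx TMA) u) & forall z, O z -> 1 = f (par (j : idx TMA) z)].
  move=> ju; have [N1 [oO Oz HO]] := slit_chart_nbhs su iu ju.
  by exists N1; split=> // z /HO[sz iz]; rewrite fE.
have sf : smooth_fun TMA f u.
  move=> j ju; have [N1 [oO Oz HO]] := f1 j ju.1.
  exists N1; split=> // k.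
  exact: (is_Ck_ext oO HO (@is_Ck_cst R _ R k N1 1)).
have af : act (i : idx TMA) u X f = 0.
  have [N1 [oO Oz HO]] := f1 i iu; rewrite /act.
  have EO : \forall z \near crd (i : idx TMA) u, cst 1 z = f (par (i : idx TMA) z).
    exact: near_open oO Oz HO.
  by rewrite -(near_eq_diff EO) diff_cst.
have iu' := TM_dom su iu.
have H := cov_leibniz lD su iu' tX sf sxi.
have H' := cov_leibniz lD su iu' tX sf sxi'.
rewrite af fE// !scale0r !add0r !scale1r in H; rewrite af fE// !scale0r !add0r !scale1r in H'.
rewrite -H -H'; congr (D u X _); apply/funext => w; rewrite /f.
by case: asboolP => [[sw iw]|_]; rewrite ?scale0r// E.
Qed.

End Connections.

(** * Concurrent fields *)

Section Concurrent.
Context {R : realType} {M : topologicalType} {n : nat} {A : @atlas R M n}.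
Context (hM : smooth_manifold A).
Notation TMA := (TM_atlas A).
Context {L : TM A -> R} (hL : finsler_structure L).
Context {D : cov A} (hD : cartan_connection L D).
Context {zeta : TM A -> tvec A} (hz : concurrent D zeta).

Let lD : linear_connection D := cartan_linear hD.

Lemma zeta_smooth u : slit u -> smooth_pi_field zeta u.
Proof. by move=> su; exact: (conc_field hz su).2. Qed.

Lemma zeta_tangent u : slit u -> pi_fib u (zeta u).
Proof. by move=> su; exact: (conc_field hz su).1. Qed.

(** Concurrency itself provides the horizontal lifts.  If [v] had none, then
    [beta D u v] would be the default value 0, and concurrency would read
    [D_0 zeta = - v]; so [v = 0], which is lifted by 0. *)
Lemma beta_horizontal_lift u v : slit u -> pi_fib u v ->
  horizontal D u (beta D u v) /\ rho (beta D u v) = v.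
Proof.
move=> su tv; rewrite /beta.
pose S : set (tvec TMA) := [set X | horizontal D u X /\ rho X = v].
have [SX|nS] := pselect (exists X, S X); first exact: xgetPex SX.
have b0 : beta D u v = 0 by apply: xgetPN => X SX; apply: nS; exists X.
have v0 : v = 0.
  have := conc_horizontal hz su tv; rewrite b0.
  rewrite (cov_zero_vector lD su (zeta_smooth su)) => /esym/eqP.
  by rewrite oppr_eq0 => /eqP.
case: nS; exists 0; split; last by apply/funext => j; rewrite v0 /rho linear0.
have [+ _] := cartan_regular hD su.
by move/seteqP => [_ /(_ 0 erefl)[]].
Qed.

(** * Concurrent fields in a chart *)

Context (i : idx A).
Implicit Types (z : 'rV[R]_(n + n)) (a b c w : 'rV[R]_n).

Local Notation U := (@tdom R M n A i).
Local Notation vert a := (row_mx (0 : 'rV[R]_n) a).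
Local Notation P z := (par (i : idx TMA) z).
Local Notation g := (@chart_metric R M n A L i).
Local Notation frame b := (fun u : TM A => tvec_of i u.1 b).

Definition zeta_chart z : 'rV[R]_n := zeta (P z) i.

Lemma dom_P z : U z -> dom i (P z).1.
Proof. by move=> [iz _]; exact: (TM_dom_par hM iz).1. Qed.

Lemma smooth_pi_field_tangent (Y : TM A -> tvec A) z : U z ->
  smooth_pi_field Y (P z) -> \forall z' \near z, pi_fib (P z') (Y (P z')).
Proof.
by move=> [iz _] /(_ i (TM_dom_par hM iz))[+ _]; rewrite (TM_crd_par hM iz).
Qed.

Lemma metric_chart (Y Z : TM A -> tvec A) z (X : tvec TMA) : U z -> tangent (P z) X ->
  smooth_pi_field Y (P z) -> smooth_pi_field Z (P z) ->
  'd (fun z => g z (Y (P z) i) (Z (P z) i)) z (X i) =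
  g z (D (P z) X Y i) (Z (P z) i) + g z (Y (P z) i) (D (P z) X Z i).
Proof.
move=> Uz tX sY sZ; have iz := Uz.1; have su := slit_par hM Uz.
have fY := smooth_pi_field_tangent Uz sY; have fZ := smooth_pi_field_tangent Uz sZ.
have cz := TM_crd_par hM iz.
have H := cartan_metric hD su (TM_dom_par hM iz) tX sY sZ.
rewrite /act cz in H.
have tY : pi_fib (P z) (Y (P z)) := nbhs_singleton fY.
have tZ : pi_fib (P z) (Z (P z)) := nbhs_singleton fZ.
have tDY := cov_fib lD su tX sY; have tDZ := cov_fib lD su tX sZ.
have gE v v' : pi_fib (P z) v -> pi_fib (P z) v' ->
    finsler_metric L (P z) v v' = g z (v i) (v' i).
  by move=> tv tw; rewrite (finsler_metricE hM su (dom_P Uz) tv tw) cz.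
rewrite (gE _ _ tDY tZ) (gE _ _ tY tDZ) in H.
rewrite -H; apply: (congr1 (@^~ (X i))); apply: near_eq_diff.
have nU : nbhs z U by apply: open_nbhs_nbhs; split=> //; exact: tdom_open.
apply: filterS (filterI nU (filterI fY fZ)) => z' [Uz' [fY' fZ']].
have H' := @finsler_metricE _ _ _ _ hM L _ _ _ _ (slit_par hM Uz') (dom_P Uz') fY' fZ'.
rewrite (TM_crd_par hM Uz'.1) in H'; exact (esym H').
Qed.

Lemma zeta_chart_differentiable z : U z -> differentiable zeta_chart z.
Proof.
move=> Uz; have [_ [N [_ Nz C]]] := zeta_smooth (slit_par hM Uz) (TM_dom_par hM Uz.1).
have [dz _] := C 1%N; apply: dz; by rewrite -(TM_crd_par hM Uz.1).
Qed.

Lemma vertical_tangent z a : U z -> tangent (P z) (gamma (tvec_of i (P z).1 a)).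
Proof.
move=> Uz; apply: (gamma_tangent hM (slit_par hM Uz)).
exact: tvec_of_tangent (dom_P Uz).
Qed.

Lemma gamma_frame z a : U z -> gamma (tvec_of i (P z).1 a) i = vert a.
Proof. by move=> Uz; rewrite /gamma tvec_of_chart//; exact: dom_P. Qed.

Lemma cov_vertical z a : U z -> D (P z) (gamma (tvec_of i (P z).1 a)) zeta = 0.
Proof.
move=> Uz; apply: (conc_vertical hz (slit_par hM Uz)).
exact: tvec_of_tangent (dom_P Uz).
Qed.

Definition zeta_sqnorm z := g z (zeta_chart z) (zeta_chart z).

Lemma zeta_sqnorm_differentiable z : U z -> differentiable zeta_sqnorm z.
Proof.
by move=> Uz; apply: chart_metric_differentiable => //; exact: zeta_chart_differentiable.
Qed.

Lemma zeta_sqnorm_vertical z a : U z -> 'd zeta_sqnorm z (vert a) = 0.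
Proof.
move=> Uz; have sz := zeta_smooth (slit_par hM Uz).
have := metric_chart Uz (vertical_tangent a Uz) sz sz.
rewrite (gamma_frame a Uz) (cov_vertical a Uz) => ->.
rewrite -[(0 : tvec A) i]/(0 : 'rV[R]_n).
by rewrite (chart_metric_sym hM hL _ 0 Uz) (chart_metric0l hM hL _ Uz) addr0.
Qed.

(** The horizontal derivative of [g(zeta, zeta)] along the lift of [a] is
    [- 2 g(zeta, a)]; as the vertical derivatives vanish, the lift can be
    replaced by [(a, 0)]. *)
Lemma zeta_sqnorm_horizontal z a : U z ->
  'd zeta_sqnorm z (row_mx a 0) = - 2 * g z (zeta_chart z) a.
Proof.
move=> Uz; have su := slit_par hM Uz; have sz := zeta_smooth su.
have tv : pi_fib (P z) (tvec_of i (P z).1 a) := tvec_of_tangent hM a (dom_P Uz).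
have [[tX _] rX] := beta_horizontal_lift su tv.
have := metric_chart Uz tX sz sz.
rewrite (conc_horizontal hz su tv).
have Xi : lsubmx (beta D (P z) (tvec_of i (P z).1 a) i) = a.
  by rewrite -[LHS]/(rho _ i) rX tvec_of_chart//; exact: dom_P.
rewrite -[beta _ _ _ i]hsubmxK Xi; set y := rsubmx _.
have -> : row_mx a y = row_mx a 0 + vert y by rewrite add_row_mx addr0 add0r.
rewrite linearD => H; have := zeta_sqnorm_vertical y Uz => V.
have na : (- tvec_of i (P z).1 a) i = - a.
  by rewrite -[LHS]/(- (tvec_of i (P z).1 a i)) tvec_of_chart//; exact: dom_P.
rewrite na in H.
have {}H : 'd zeta_sqnorm z (row_mx a 0) + 'd zeta_sqnorm z (vert y) =
   g z (- a) (zeta_chart z) + g z (zeta_chart z) (- a) := H.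
rewrite V addr0 in H; rewrite H (chart_metric_sym hM hL (zeta_chart z) _ Uz).
rewrite (chart_metricNl hM hL _ _ Uz).
by rewrite (chart_metric_sym hM hL a _ Uz) mulNr mulr_natl mulr2n opprD.
Qed.

Local Notation slit_vectors := [set v : 'rV[R]_n | v != 0].

Lemma component_neq0 y y' : connected_component slit_vectors y y' ->
  y != 0 /\ y' != 0.
Proof.
by move=> H; split; [have := connected_component_sub (connected_component_sym H)|
  have := connected_component_sub H].
Qed.

(** In the chart, [alpha] is [- 1/2] times the base derivative of
    [g(zeta, zeta)], a function of [x] alone on each component of the fibres. *)
Lemma form_y_indep x y y' a : rng i x -> connected_component slit_vectors y y' ->
  g (row_mx x y) (zeta_chart (row_mx x y)) a =
  g (row_mx x y') (zeta_chart (row_mx x y')) a.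
Proof.
move=> ix yy'; have [y0 y'0] := component_neq0 yy'.
have E x' : rng i x' -> zeta_sqnorm (row_mx x' y) = zeta_sqnorm (row_mx x' y').
  move=> ix'; apply: (vertical_cst (i := i) zeta_sqnorm_differentiable) => //.
  by move=> z w Uz; exact: zeta_sqnorm_vertical.
have H := diff_horizontal_eq hM (i := i) zeta_sqnorm_differentiable a ix y0 y'0 E.
have Hy := zeta_sqnorm_horizontal a (tdom_row ix y0).
have Hy' := zeta_sqnorm_horizontal a (tdom_row ix y'0).
apply: (mulfI (_ : - 2 != 0 :> R)); first by rewrite oppr_eq0 pnatr_eq0.
exact: etrans (esym Hy) (etrans H Hy').
Qed.

Lemma form_vertical z b a : U z -> 'd (fun z => g z (zeta_chart z) b) z (vert a) = 0.
Proof.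
move=> [iz z0]; rewrite -[z in 'd _ z]hsubmxK.
apply: (diff_vertical0 (phi := fun z => g z (zeta_chart z) b) a iz z0) => y' yy'.
exact/esym/form_y_indep.
Qed.

Lemma frame_smooth z b : U z -> smooth_pi_field (frame b) (P z).
Proof. by move=> Uz; exact (smooth_frame hM b (TM_dom_par hM Uz.1)). Qed.

(** The vertical connection coefficients of the chart, contracted with [a] and
    [b]. *)
Definition vcov z a b : 'rV[R]_n := D (P z) (gamma (tvec_of i (P z).1 a)) (frame b) i.

Lemma frame_chart z b : U z -> (frame b) (P z) i = b.
Proof. by move=> Uz; exact (tvec_of_chart hM b (dom_P Uz)). Qed.

Lemma near_frame_chart z b : U z -> \forall z' \near z, (frame b) (P z') i = b.
Proof.
move=> Uz; have oU : open U by exact: tdom_open.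
exact: near_open oU Uz (fun z' Uz' => frame_chart b Uz').
Qed.

Lemma metric_frames z a b c : U z ->
  'd (fun z => g z b c) z (vert a) = g z (vcov z a b) c + g z b (vcov z a c).
Proof.
move=> Uz; have := metric_chart Uz (vertical_tangent a Uz) (frame_smooth b Uz) (frame_smooth c Uz).
rewrite (gamma_frame a Uz) (frame_chart b Uz) (frame_chart c Uz) => <-.
apply: (congr1 (@^~ (vert a))); apply: near_eq_diff.
have nb := near_frame_chart b Uz; have nc := near_frame_chart c Uz.
by apply: filterS (filterI nb nc) => z' [-> ->].
Qed.

(** By metricity this is the vertical derivative of [g(zeta, b)], the vertical
    covariant derivative of [zeta] being zero; and [form_y_indep] makes
    [g(zeta, b)] locally constant along the fibres. *)
Lemma zeta_vcov z a b : U z -> g z (zeta_chart z) (vcov z a b) = 0.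
Proof.
move=> Uz; have := metric_chart Uz (vertical_tangent a Uz)
  (zeta_smooth (slit_par hM Uz)) (frame_smooth b Uz).
rewrite (gamma_frame a Uz) (cov_vertical a Uz) -[(0 : tvec A) i]/(0 : 'rV[R]_n).
rewrite (chart_metric0l hM hL _ Uz) add0r => <-.
rewrite -(form_vertical b a Uz).
apply: (congr1 (@^~ (vert a))); apply: near_eq_diff.
by apply: filterS (near_frame_chart b Uz) => z' ->.
Qed.

(** Where [F] is differentiable this is the chain rule; elsewhere ['d F x] is
    zero. *)
Lemma lsubmx_diff0 (V : normedModType R) (F : V -> 'rV[R]_(n + n)) x v :
  'd (lsubmx \o F) x v = 0 -> lsubmx ('d F x v) = 0.
Proof.
have [dF|nF] := pselect (differentiable F x); last first.
  by move=> _; rewrite (diff_not_differentiable nF) /= linear0.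
pose l : {linear 'rV[R]_(n + n) -> 'rV[R]_n} := lsubmx.
have [dl El] := diff_linear l (F x).
have E := congr1 (@^~ v) (diff_comp dF dl).
by rewrite -[lsubmx \o F]/(l \o F) => H; move: E; rewrite /= H El => <-.
Qed.

(** The horizontal part of the bracket is the vertical derivative of
    [rho (beta b)], which is [b] and depends on the base point only.  It is zero
    even where [beta b] is not differentiable, thanks to [lsubmx_diff0]. *)
Lemma rho_bracket_frames z a b : U z ->
  rho (lie_bracket (fun u => gamma (frame a u)) (fun u => beta D u (frame b u)) (P z)) = 0.
Proof.
move=> Uz; have su := slit_par hM Uz; have iu := dom_P Uz.
apply/funext => j; rewrite /rho /lie_bracket.
case: asboolP => [ju|_]; last by rewrite linear0.
rewrite linearB /=.
have -> : lsubmx ('d (fun z => gamma (frame a (@par _ _ _ TMA j z)) j)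
    (@crd _ _ _ TMA j (P z)) (beta D (P z) (frame b (P z)) j)) = 0.
  apply: lsubmx_diff0.
  have -> : lsubmx \o (fun z => gamma (frame a (@par _ _ _ TMA j z)) j) = cst 0.
    by apply/funext => z'; rewrite /= /gamma row_mxKl.
  by rewrite diff_cst.
rewrite subr0; apply: lsubmx_diff0.
pose G (z' : 'rV[R]_(n + n)) := tvec_of i (@par _ _ _ A j (lsubmx z')) b j.
have [N [oN Nz HN]] := slit_chart_nbhs hM su iu ju.1.
have EG : \forall z' \near @crd _ _ _ TMA j (P z),
    (lsubmx \o (fun z => beta D (@par _ _ _ TMA j z) (frame b (@par _ _ _ TMA j z)) j)) z' = G z'.
  have EN z' : N z' -> (lsubmx \o (fun z => beta D (@par _ _ _ TMA j z)
      (frame b (@par _ _ _ TMA j z)) j)) z' = G z'.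
    move=> /HN[sz' iz'].
    have tb := tvec_of_tangent hM b iz'.
    exact (congr1 (fun v : tvec A => v j) (beta_horizontal_lift sz' tb).2).
  exact: near_open oN Nz EN.
rewrite (near_eq_diff EG); apply: diff0P; apply: derive_line_cst.
apply: (near_open openT I) => t _; by rewrite /G lsubmx_vert.
Qed.

(** Of the three terms of the torsion the bracket term is zero by
    [rho_bracket_frames], and the second one differentiates [rho (gamma a) = 0].
    The first one is evaluated by locality, [rho (beta b)] being [b] near the
    point. *)
Lemma vh_torsion_frames z a b : U z ->
  vh_torsion D (frame a) (frame b) (P z) =
  D (P z) (gamma (tvec_of i (P z).1 a)) (frame b).
Proof.
move=> Uz; have su := slit_par hM Uz; have iu := dom_P Uz.
rewrite /vh_torsion /torsion (rho_bracket_frames a b Uz) subr0.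
have -> : (fun u => rho (gamma (frame a u))) = fun=> 0.
  by apply/funext => u; apply/funext => j; rewrite /rho /gamma row_mxKl.
have [[tb _] _] := beta_horizontal_lift su (tvec_of_tangent hM b iu).
rewrite (cov_zero lD su tb) subr0; apply/esym.
apply: (cov_local hM lD su iu (vertical_tangent a Uz) (frame_smooth b Uz)) => u su' iu'.
exact/esym/(beta_horizontal_lift su' (tvec_of_tangent hM b iu')).2.
Qed.

Lemma vcov_sym z a b c : U z -> g z (vcov z a b) c = g z (vcov z a c) b.
Proof.
move=> Uz; have su := slit_par hM Uz; have iu := dom_P Uz.
have H := cartan_vh hD su (frame_smooth a Uz) (frame_smooth b Uz) (frame_smooth c Uz).
rewrite (vh_torsion_frames a b Uz) (vh_torsion_frames a c Uz) in H.
have tb := tvec_of_tangent hM b iu; have tc := tvec_of_tangent hM c iu.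
have tDb := cov_fib lD su (vertical_tangent a Uz) (frame_smooth b Uz).
have tDc := cov_fib lD su (vertical_tangent a Uz) (frame_smooth c Uz).
have Hb := @finsler_metricE _ _ _ _ hM L _ _ _ _ su iu tDb tc.
have Hc := @finsler_metricE _ _ _ _ hM L _ _ _ _ su iu tDc tb.
rewrite (TM_crd_par hM Uz.1) (tvec_of_chart hM c iu) in Hb.
rewrite (TM_crd_par hM Uz.1) (tvec_of_chart hM b iu) in Hc.
cbv beta in H; exact (etrans (esym Hb) (etrans H Hc)).
Qed.

(** The Cartan tensor vanishes on [zeta].  In [metric_frames] for the frame field
    that takes the value [zeta] at [z], the symmetry of the torsion makes the
    first term equal to the second, which is zero by [zeta_vcov]. *)
Lemma metric_vertical_zeta z a b : U z ->
  'd (fun z' => g z' (zeta_chart z) b) z (vert a) = 0.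
Proof.
move=> Uz; have G0 c : g z (vcov z a c) (zeta_chart z) = 0.
  by rewrite (chart_metric_sym hM hL _ _ Uz) zeta_vcov.
rewrite metric_frames// (vcov_sym _ _ _ Uz) G0 add0r.
by rewrite zeta_vcov.
Qed.

(** In the vertical derivative of [g(zeta, b)], which is zero by [form_vertical],
    the term where the metric is differentiated is zero by
    [metric_vertical_zeta]; so [d_a zeta] is orthogonal to every [b]. *)
Lemma zeta_chart_vertical z a : U z -> 'd zeta_chart z (vert a) = 0.
Proof.
move=> Uz; have dz := zeta_chart_differentiable Uz.
rewrite -(deriveE _ dz); apply: (chart_metric_nondegenerate hM hL Uz) => b.
have [dh Dh] := contract_diff hM hL (vert a) b Uz dz.
have dg : differentiable (fun z' => g z' (zeta_chart z) b) z.
  by have [dg _] := chart_metric_Ck hM hL i 1%N (zeta_chart z) b; exact: dg.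
have Dh0 := etrans (deriveE (vert a) dh) (form_vertical b a Uz).
have Dg0 := etrans (deriveE (vert a) dg) (metric_vertical_zeta a b Uz).
have E := etrans (esym Dh0) (etrans Dh (congr1 ( +%R _) Dg0)).
by rewrite addr0 in E; exact (esym E).
Qed.

Lemma zeta_chart_y_indep x y y' : rng i x -> connected_component slit_vectors y y' ->
  zeta_chart (row_mx x y) = zeta_chart (row_mx x y').
Proof.
move=> ix yy'; apply/rowP => k.
have dk z (Uz : U z) v := derive_row_coord v k (zeta_chart_differentiable Uz).
apply: (vertical_cst (i := i) (phi := fun z => zeta_chart z 0 k)) => //.
  by move=> z Uz; exact: (dk z Uz 0).1.
move=> z w Uz; rewrite -(deriveE _ (dk z Uz (vert w)).1) (dk z Uz (vert w)).2.
by rewrite (deriveE _ (zeta_chart_differentiable Uz)) (zeta_chart_vertical w Uz) mxE.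
Qed.

End Concurrent.

Theorem theorem2p7 (R : realType) (n : nat) (M : topologicalType)
    (A : @atlas R M n) (hM : smooth_manifold A)
    (L : TM A -> R) (hL : finsler_structure L)
    (D : cov A) (hD : cartan_connection L D)
    (zeta : TM A -> tvec A) (hzeta : concurrent D zeta) :
  pi_field_y_independent zeta /\
  pi_form_y_independent (associated_form L zeta).
Proof.
have component y y' : y != 0 -> y' != 0 ->
    (1 < n)%N \/ connected_component [set v : 'rV[R]_n | v != 0] y y' ->
    connected_component [set v : 'rV[R]_n | v != 0] y y'.
  by move=> y0 y'0 [n1|//]; exact: nonzero_vectors_connected.
split=> i x y y' ix y0 y'0 /(component y y' y0 y'0) yy'.
  exact: (zeta_chart_y_indep hM hL hD hzeta ix yy').
apply: eq_mx => _ k.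
have chartE v (v0 : v != 0) : finsler_metric L (@par _ _ _ (TM_atlas A) i (row_mx x v))
    (zeta (@par _ _ _ (TM_atlas A) i (row_mx x v)))
    (coord_vec i (@par _ _ _ (TM_atlas A) i (row_mx x v)).1 k) =
    @chart_metric R M n A L i (row_mx x v) (zeta (@par _ _ _ (TM_atlas A) i (row_mx x v)) i)
      (delta_mx 0 k).
  have Uz := tdom_row ix v0; have iu := dom_P hM Uz; have su := slit_par hM Uz.
  have H := @finsler_metricE _ _ _ _ hM L _ _ _ _ su iu (zeta_tangent hzeta su)
    (tvec_of_tangent hM (delta_mx 0 k) iu).
  by rewrite (TM_crd_par hM Uz.1) (tvec_of_chart hM _ iu) in H.
have E := form_y_indep hM hL hD hzeta (delta_mx 0 k) ix yy'.
exact (etrans (chartE y y0) (etrans E (esym (chartE y' y'0)))).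
Qed.
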